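(* Let $p$, $n$ and $k$ be integers with $p\ge 1$, $k\ge 2$ and $p^k\le n$. Then there exists a constant $K$ depending only on $k$ such that for every $\sigma\in S_p$, $$\mathrm{Wg}(n,\sigma)\le K\, n^{-p-|\sigma|(1-2/k)}.$$
   Context: For $\sigma\in S_p$, $|\sigma|$ is the minimal number of transpositions whose product is $\sigma$; equivalently $|\sigma|=p-\#\sigma$ where $\#\sigma$ is the number of cycles of $\sigma$. The Weingarten function is $\mathrm{Wg}(n,\sigma)=\frac{1}{p!^2}\sum_{\lambda\vdash p}\frac{(\chi^\lambda(1))^2\chi^\lambda(\sigma)}{s_{\lambda,n}(1)}$, where the sum is over partitions $\lambda$ of $p$, $\chi^\lambda$ is the irreducible character of $S_p$ indexed by $\lambda$, and $s_{\lambda,n}(1)=s_\lambda(1,\dots,1)$ is the Schur polynomial in $n$ variables evaluated at all ones. *)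

(* Defs.v *)
From HB Require Import structures.
From mathcomp Require Import all_boot all_order all_algebra all_fingroup.
From mathcomp Require Import mxrepresentation classfun character algC.
Set Implicit Arguments. Unset Strict Implicit. Unset Printing Implicit Defensive.
Import Order.TTheory GRing.Theory Num.Theory.
Local Open Scope ring_scope.

(* A partition of p is encoded as a p-tuple (lambda_0 >= lambda_1 >= ... ),
   padded with zeros, with parts <= p and sum p.  Every partition of p has at
   most p nonzero parts, each <= p, so this is a bijective encoding. *)
Definition is_partition (p : nat) (la : p.-tuple 'I_p.+1) : bool :=
  [forall i : 'I_p, forall j : 'I_p, (i <= j)%N ==> (tnth la j <= tnth la i)%N]
  && (\sum_(i < p) (tnth la i : nat) == p)%N.

(* Cells of the Young diagram are numbered 0..p-1 in row-reading order
   (the canonical Young tableau).  row_of / col_of give the (0-based) row and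
   column of cell t. *)
Definition row_of (p : nat) (la : p.-tuple 'I_p.+1) (t : 'I_p) : nat :=
  #|[set r : 'I_p | (\sum_(i < p | (i <= r)%N) (tnth la i : nat) <= t)%N]|.

Definition col_of (p : nat) (la : p.-tuple 'I_p.+1) (t : 'I_p) : nat :=
  (t - \sum_(i < p | (i < row_of la t)%N) (tnth la i : nat))%N.

Definition row_group (p : nat) (la : p.-tuple 'I_p.+1) : {set 'S_p} :=
  [set s : 'S_p | [forall t : 'I_p, row_of la (s t) == row_of la t]].
Definition col_group (p : nat) (la : p.-tuple 'I_p.+1) : {set 'S_p} :=
  [set s : 'S_p | [forall t : 'I_p, col_of la (s t) == col_of la t]].

Definition Sym (p : nat) : {group 'S_p} := [set: 'S_p]%G.

Definition young_sym (p : nat) (la : p.-tuple 'I_p.+1) : 'rV[algC]_(gcard (Sym p)) :=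
  \sum_(g in row_group la) \sum_(h in col_group la)
     ((-1) ^+ (odd_perm h)) *: delta_mx 0 (gring_index (Sym p) (g * h)).

(* The Specht module: the (right) ideal generated by c_la in the group algebra,
   as a submodule of the regular representation; chi^la is its character. *)
Definition specht_repr (p : nat) (la : p.-tuple 'I_p.+1) :=
  submod_repr (cyclic_mx_module (regular_repr algC (Sym p)) (young_sym la)).

Definition chi (p : nat) (la : p.-tuple 'I_p.+1) : 'CF(Sym p) :=
  cfRepr (specht_repr la).

(* s_{la,n}(1,...,1): the Schur polynomial in n variables
   s_la = sum over semistandard tableaux T of shape la with entries in
   {1..n} of x^T, evaluated at x = (1,...,1); i.e. the number of such SSYT. *)
Definition schur_one (p n : nat) (la : p.-tuple 'I_p.+1) : nat :=
  #|[set T : {ffun 'I_p -> 'I_n} |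
     [forall t : 'I_p, forall u : 'I_p,
        ((row_of la t == row_of la u) && (col_of la t < col_of la u)%N
           ==> (T t <= T u)%N)
        && ((col_of la t == col_of la u) && (row_of la t < row_of la u)%N
           ==> (T t < T u)%N)]]|.

Definition Wg (p n : nat) (s : 'S_p) : algC :=
  (p`!%:R ^+ 2)^-1 *
  \sum_(la : p.-tuple 'I_p.+1 | is_partition la)
     (chi la 1%g) ^+ 2 * chi la s / (schur_one n la)%:R.

(* |s| = p - #cycles(s); porbits s is the set of cycles (fixed points count). *)
Definition perm_length (p : nat) (s : 'S_p) : nat := (p - #|porbits s|)%N.

(* Main.v *)
Require Import Defs.
From HB Require Import structures.
From mathcomp Require Import all_boot all_order all_algebra all_fingroup.
From mathcomp Require Import mxrepresentation classfun character algC.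
From mathcomp Require Import zify.
Set Implicit Arguments. Unset Strict Implicit. Unset Printing Implicit Defensive.
Import Order.TTheory GRing.Theory Num.Theory.
Local Open Scope ring_scope.

(* Let pi be the character of the permutation action of S_p on functions
   [p] -> [n]; its value at s is n^#s.  If pi = sum_la s_la(1^n) chi^la, then by
   the orthogonality relations Wg is the convolution inverse of pi, so
   n^p Wg inverts 1 + sum_(z <> 1) n^(-|z|) z.  In the submultiplicative norm
   sum_z |f z| w^|z| with w = n / p^2, the second summand has norm
   sum_(z <> 1) p^(-2|z|) <= 3/4 (Burnside, applied to functions [p] -> [p^2]),
   whence |Wg n s| <= 4 n^(-p) (p^2 / n)^|s|, and p <= n^(1/k).

   The decomposition of pi: the Young symmetrizer c = ab (a the row sum, b the
   alternating column sum) satisfies c c = gamma c, so the multiplicity of chi^la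
   in any representation is the rank of c acting on it.  On functions this rank
   is the number of semistandard tableaux, from below by a triangularity
   argument and from above by Garnir straightening.  The chi^la are distinct
   irreducible characters, and there are no others since there are at most as
   many conjugacy classes as partitions. *)

(** * Young diagrams *)

(** [Wg] has tableau counts in its denominators, so pi must be decomposed with exactly these
    multiplicities; hence both bounds on the rank. The scalars gamma and tau(x) in c x c = tau(x) c
    are fixed before the representation is chosen: what the regular representation reveals about
    them, where c has trace p!, is then available for functions [p] -> [n]. Partitions are compared
    through [\sum_t row_of la t] instead of the dominance order; any two are comparable, so
    orthogonality needs only one of the two directions. The hypothesis enters as p^2 <= n: it gives
    w >= 1, which makes w^|z| submultiplicative, and p <= n, which keeps every multiplicity nonzero.
    The base p^2 comes from sum_z t^|z| = prod_(i < p) (1 + i t), which is at most exp(1/2) < 7/4 at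
    t = p^(-2); the constant 4 is 1 / (1 - 3/4). *)

Definition row_start (p : nat) (la : p.-tuple 'I_p.+1) (m : nat) : nat :=
  \sum_(i < p | (i < m)%N) (tnth la i : nat).

Lemma row_startS p (la : p.-tuple 'I_p.+1) (i : 'I_p) :
  row_start la i.+1 = (row_start la i + tnth la i)%N.
Proof.
rewrite /row_start (bigD1 i) //= addnC; congr (_ + _)%N.
by apply: eq_bigl => j; rewrite ltnS -val_eqE /=; lia.
Qed.

Lemma row_start_mono p (la : p.-tuple 'I_p.+1) m n :
  (m <= n)%N -> (row_start la m <= row_start la n)%N.
Proof.
move=> le_mn; rewrite /row_start big_mkcond [X in (_ <= X)%N]big_mkcond /=.
apply: leq_sum => i _; case: ifP => // lt_im.
by rewrite (leq_trans lt_im le_mn).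
Qed.

Lemma row_start_end p (la : p.-tuple 'I_p.+1) : is_partition la -> row_start la p = p.
Proof.
case/andP=> _ /eqP sum_la; rewrite -[RHS]sum_la.
by apply: eq_bigl => i; apply: ltn_ord.
Qed.

Lemma partition_noninc p (la : p.-tuple 'I_p.+1) (i j : 'I_p) :
  is_partition la -> (i <= j)%N -> (tnth la j <= tnth la i)%N.
Proof. by case/andP=> /forallP/(_ i)/forallP/(_ j)/implyP h _ /h. Qed.

Lemma row_ofE p (la : p.-tuple 'I_p.+1) (t : 'I_p) :
  row_of la t = #|[set r : 'I_p | (row_start la r.+1 <= t)%N]|.
Proof. by []. Qed.

Lemma card_ord_lt p i : (i <= p)%N -> #|[set r : 'I_p | (r < i)%N]| = i.
Proof.
move=> le_ip; rewrite cardE -(size_map val) -[RHS](size_iota 0).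
apply/perm_size/uniq_perm; rewrite ?iota_uniq //.
  by rewrite map_inj_uniq ?enum_uniq //; apply: val_inj.
move=> j; rewrite mem_iota /= add0n; apply/mapP/idP => [[x]|lt_ji].
  by rewrite mem_enum inE => h ->.
by exists (Ordinal (leq_trans lt_ji le_ip)); rewrite ?mem_enum ?inE.
Qed.

Lemma row_of_unique p (la : p.-tuple 'I_p.+1) (t i : 'I_p) :
  (row_start la i <= t < row_start la i.+1)%N -> row_of la t = i.
Proof.
case/andP=> h1 h2; rewrite row_ofE -[RHS](card_ord_lt (ltnW (ltn_ord i))).
apply: eq_card => r; rewrite !inE; apply/idP/idP => h; last first.
  exact: leq_trans (row_start_mono la h) h1.
by rewrite ltnNge; apply/negP => h'; have := row_start_mono la (h' : (i < r.+1)%N); lia.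
Qed.

Lemma row_of_bounds p (la : p.-tuple 'I_p.+1) (t : 'I_p) : is_partition la ->
  exists2 i : 'I_p, row_of la t = i & (row_start la i <= t < row_start la i.+1)%N.
Proof.
move=> hla; have ex : exists m, (t < row_start la m)%N.
  by exists p; rewrite row_start_end.
case: (ex_minnP ex) => -[|m]; first by rewrite /row_start big_pred0.
move=> lt_m min_m; have lt_mp : (m < p)%N by apply: (min_m p); rewrite row_start_end.
have le_m : (row_start la m <= t)%N.
  by rewrite leqNgt; apply/negP => /min_m; rewrite ltnn.
by exists (Ordinal lt_mp); rewrite ?le_m //; apply: row_of_unique; rewrite /= le_m.
Qed.

Lemma cellP p (la : p.-tuple 'I_p.+1) (t : 'I_p) : is_partition la ->
  exists i : 'I_p, [/\ row_of la t = i, (col_of la t < tnth la i)%N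
                     & t = (row_start la i + col_of la t)%N :> nat].
Proof.
move=> hla; have [i ri /andP[h1 h2]] := row_of_bounds t hla; exists i.
have -> : col_of la t = (t - row_start la i)%N by rewrite /col_of ri.
move: h2; rewrite row_startS => h2; split => //; lia.
Qed.

Lemma cell_exists p (la : p.-tuple 'I_p.+1) (i : 'I_p) j : is_partition la ->
  (j < tnth la i)%N -> exists t : 'I_p, row_of la t = i /\ col_of la t = j.
Proof.
move=> hla lt_j; have h2 : (row_start la i + j < row_start la i.+1)%N.
  by rewrite row_startS ltn_add2l.
have h3 : (row_start la i + j < p)%N.
  by apply: leq_trans h2 _; rewrite -[X in (_ <= X)%N](row_start_end hla); apply: row_start_mono.
pose t := Ordinal h3; have rt : row_of la t = i by apply: row_of_unique; rewrite /= h2 leq_addr.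
by exists t; split => //; rewrite /col_of rt /= -/(row_start la i) addKn.
Qed.

Lemma cell_inj p (la : p.-tuple 'I_p.+1) (t u : 'I_p) : is_partition la ->
  row_of la t = row_of la u -> col_of la t = col_of la u -> t = u.
Proof.
move=> hla; have [i [ri _ ti]] := cellP t hla; have [j [rj _ uj]] := cellP u hla.
by rewrite ri rj => /val_inj eij ec; apply: val_inj; rewrite /= ti uj eij ec.
Qed.

Lemma row_of_lt p (la : p.-tuple 'I_p.+1) (t : 'I_p) : is_partition la -> (row_of la t < p)%N.
Proof. by move=> hla; have [i [-> _ _]] := cellP t hla. Qed.

(** Here the parts being nonincreasing is used: columns have no gaps. *)
Lemma cell_closed p (la : p.-tuple 'I_p.+1) (t : 'I_p) i j : is_partition la ->
  (i <= row_of la t)%N -> (j <= col_of la t)%N ->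
  exists u : 'I_p, row_of la u = i /\ col_of la u = j.
Proof.
move=> hla; have [r [-> lt_c _]] := cellP t hla => le_i le_j.
have lt_ip := leq_ltn_trans le_i (ltn_ord r).
apply: (@cell_exists _ la (Ordinal lt_ip)) => //.
by apply: leq_ltn_trans le_j (leq_trans lt_c _); apply: partition_noninc.
Qed.

Lemma card_row p (la : p.-tuple 'I_p.+1) (i : 'I_p) : is_partition la ->
  #|[set t | row_of la t == i]| = tnth la i.
Proof.
move=> hla.
have le_ip : (tnth la i <= p)%N by rewrite -ltnS ltn_ord.
have inj : {in [set t | row_of la t == i] &, injective (fun t => inord (col_of la t) : 'I_p.+1)}.
  move=> t u; rewrite !inE => /eqP rt /eqP ru /(congr1 val); have [j [rj cj _]] := cellP t hla.
  have [k [rk ck _]] := cellP u hla; have := ltn_ord (tnth la j); have := ltn_ord (tnth la k) => h h'.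
  rewrite /= !inordK; [|lia|lia].
  by apply: cell_inj => //; rewrite rt ru.
rewrite -(card_in_imset inj) -[RHS](@card_ord_lt p.+1); last exact: leqW.
apply: eq_card => j; rewrite inE; apply/imsetP/idP => [[t]|lt_j].
  rewrite inE => /eqP rt ->; have [k [rk ck _]] := cellP t hla.
  have e : k = i by apply: val_inj; rewrite /= -rk.
  move: ck; rewrite e => ck; rewrite inordK //; lia.
have [t [rt ct]] := cell_exists hla lt_j; exists t; rewrite ?inE ?rt ?eqxx //.
by apply: val_inj; rewrite /= ct inordK.
Qed.

Lemma row_rank p (la : p.-tuple 'I_p.+1) (t : 'I_p) : is_partition la ->
  #|[set u | (col_of la u == col_of la t) && (row_of la u < row_of la t)%N]| = row_of la t.
Proof.
move=> hla; set A := [set u | _].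
have row_small u : (row_of la u < p.+1)%N by apply: leqW; apply: row_of_lt.
have inj : {in A &, injective (fun u => inord (row_of la u) : 'I_p.+1)}.
  move=> u v; rewrite !inE => /andP[/eqP cu _] /andP[/eqP cv _] /(congr1 val).
  by rewrite /= !inordK // => r; apply: (cell_inj hla r); rewrite cu cv.
rewrite -(card_in_imset inj) -[RHS](@card_ord_lt p.+1); last exact/ltnW/ltnW/row_of_lt.
apply: eq_card => j; rewrite inE; apply/imsetP/idP => [[u]|lt_j].
  by rewrite inE => /andP[_ lt_u] ->; rewrite inordK.
have [u [ru cu]] := cell_closed hla (ltnW lt_j) (leqnn (col_of la t)).
exists u; first by rewrite inE cu ru eqxx.
by apply: val_inj; rewrite /= ru inordK.
Qed.

(** * Row sums and alternating column sums *)

Lemma card_le_bounded (T : finType) (A : {pred T}) (f : T -> nat) m :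
  {in A &, injective f} -> {in A, forall x, (f x < m)%N} -> (#|A| <= m)%N.
Proof.
move=> inj_f f_lt; rewrite cardE -(size_map f) -(size_iota 0 m).
apply: uniq_leq_size => [|j /mapP[x]].
  by rewrite map_inj_in_uniq ?enum_uniq // => x y; rewrite !mem_enum; apply: inj_f.
by rewrite mem_enum => /f_lt lt_m ->; rewrite mem_iota.
Qed.

(** Each unordered pair inside a fibre of [c] contributes one to the sum of ranks. The right side
    does not mention [V], so all functions injective on the fibres have the same sum of ranks. *)
Lemma sum_rank_double (T : finType) (c V : T -> nat) :
  (forall t u, c t = c u -> V t = V u -> t = u) ->
  ((\sum_t #|[set u | (c u == c t) && (V u < V t)]|).*2
    = \sum_t #|[set u | (c u == c t) && (u != t)]|)%N.
Proof.
move=> inj.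
have flip : (\sum_t #|[set u | (c u == c t) && (V u < V t)]|
             = \sum_t #|[set u | (c u == c t) && (V t < V u)]|)%N.
  under eq_bigr do rewrite -sum1_card big_mkcond.
  under [RHS]eq_bigr do rewrite -sum1_card big_mkcond.
  rewrite exchange_big; apply: eq_bigr => t _; apply: eq_bigr => u _.
  by rewrite !inE eq_sym.
rewrite -addnn {2}flip -big_split /=; apply: eq_bigr => t _.
rewrite -cardsUI [X in (_ + X)%N](_ : _ = 0%N) ?addn0.
  apply: eq_card => u; rewrite !inE -andb_orr; case: eqP => //= cut.
  rewrite -neq_ltn; congr (~~ _); apply/eqP/eqP => [/inj|->] //.
  by move=> ->.
by apply: eq_card0 => u; rewrite !inE; case: ltngtP; rewrite ?andbF.
Qed.

(* U t is at least the number of smaller entries in the column of t, and the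
   total of these numbers is sum_t row t; so the hypothesis forces equality and
   U enumerates each column by 0, 1, 2, ... *)
Lemma col_sort p (mu : p.-tuple 'I_p.+1) (U : 'I_p -> nat) : is_partition mu ->
  (forall t u, col_of mu t = col_of mu u -> U t = U u -> t = u) ->
  (\sum_t U t <= \sum_t row_of mu t)%N ->
  exists2 h : 'S_p, h \in col_group mu & forall t, row_of mu (h t) = U t.
Proof.
move=> hmu injU le_sum.
pose r t := #|[set u | (col_of mu u == col_of mu t) && (U u < U t)%N]|.
have le_r t : (r t <= U t)%N.
  apply: (card_le_bounded (f := U)) => [u v|u]; rewrite !inE; last by case/andP.
  by move=> /andP[/eqP cu _] /andP[/eqP cv _]; apply: injU; rewrite cu cv.
have sum_r : (\sum_t r t = \sum_t row_of mu t)%N.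
  apply: double_inj; rewrite sum_rank_double //.
  under [in RHS]eq_bigr do rewrite -row_rank //.
  by rewrite sum_rank_double // => t u cc rr; apply: cell_inj hmu rr cc.
have Ur t : U t = r t.
  apply/eqP; rewrite eqn_leq le_r andbT leqNgt; apply/negP => lt_r.
  suff : (\sum_t r t < \sum_t U t)%N by rewrite sum_r ltnNge le_sum.
  rewrite (bigD1 t) //= [X in (_ < X)%N](bigD1 t) //= -addSn.
  by apply: leq_add => //; apply: leq_sum.
(* If the column of [t] stopped before row [U t], it would have at most [U t] cells; but it contains
   [t] and the [r t = U t] cells with smaller entries. *)
have cell_ex t : exists u, (row_of mu u == U t) && (col_of mu u == col_of mu t).
  case: (pickP (fun u => (col_of mu u == col_of mu t) && (U t <= row_of mu u)%N)) => [u|no].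
    case/andP=> /eqP cu /(cell_closed hmu)/(_ (leqnn _))[v [rv cv]].
    by exists v; rewrite rv cv cu !eqxx.
  have : (#|[set u | col_of mu u == col_of mu t]| <= U t)%N.
    apply: (card_le_bounded (f := row_of mu)) => [u v|u]; rewrite !inE.
      by move=> /eqP cu /eqP cv rr; apply: cell_inj hmu rr _; rewrite cu cv.
    by move=> cu; have := no u; rewrite cu /= ltnNge => ->.
  rewrite leqNgt Ur proper_card //; apply/properP; split.
    by apply/subsetP => u; rewrite !inE => /andP[].
  by exists t; rewrite !inE ?ltnn ?andbF.
pose f t := xchoose (cell_ex t).
have fP t : row_of mu (f t) = U t /\ col_of mu (f t) = col_of mu t.
  by have /andP[/eqP ? /eqP ?] := xchooseP (cell_ex t).
have inj_f : injective f.
  move=> t u e; have [r1 c1] := fP t; have [r2 c2] := fP u; apply: injU.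
    by rewrite -c1 -c2 e.
  by rewrite -r1 -r2 e.
exists (perm inj_f) => [|t]; rewrite ?inE; last by rewrite permE; have [] := fP t.
by apply/forallP => t; rewrite permE; have [_ ->] := fP t.
Qed.

Definition row_sum p (la : p.-tuple 'I_p.+1) n (rG : mx_representation algC (Defs.Sym p) n) :=
  \sum_(r in row_group la) rG r.

Definition col_alt p (la : p.-tuple 'I_p.+1) n (rG : mx_representation algC (Defs.Sym p) n) :=
  \sum_(h in col_group la) (-1) ^+ odd_perm h *: rG h.

Lemma row_groupP p (la : p.-tuple 'I_p.+1) (s : 'S_p) :
  reflect (forall t, row_of la (s t) = row_of la t) (s \in row_group la).
Proof. by rewrite inE; apply: (iffP forallP) => h t; apply/eqP. Qed.

Lemma col_groupP p (la : p.-tuple 'I_p.+1) (s : 'S_p) :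
  reflect (forall t, col_of la (s t) = col_of la t) (s \in col_group la).
Proof. by rewrite inE; apply: (iffP forallP) => h t; apply/eqP. Qed.

Lemma row_groupM p (la : p.-tuple 'I_p.+1) (r s : 'S_p) :
  r \in row_group la -> ((s * r)%g \in row_group la) = (s \in row_group la).
Proof.
move/row_groupP => hr; apply/row_groupP/row_groupP => h t.
  by rewrite -(hr (s t)) -permM h.
by rewrite permM hr h.
Qed.

Lemma col_groupM p (la : p.-tuple 'I_p.+1) (r s : 'S_p) :
  r \in col_group la -> ((s * r)%g \in col_group la) = (s \in col_group la).
Proof.
move/col_groupP => hr; apply/col_groupP/col_groupP => h t.
  by rewrite -(hr (s t)) -permM h.
by rewrite permM hr h.
Qed.

Lemma col_groupV p (la : p.-tuple 'I_p.+1) (s : 'S_p) :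
  (s^-1%g \in col_group la) = (s \in col_group la).
Proof.
apply/col_groupP/col_groupP => h t; first by rewrite -[in RHS](permK s t) h.
by rewrite -[in RHS](permKV s t) h.
Qed.

Lemma col_groupMl p (la : p.-tuple 'I_p.+1) (r s : 'S_p) :
  r \in col_group la -> ((r * s)%g \in col_group la) = (s \in col_group la).
Proof. by move=> hr; rewrite -(col_groupV la (r * s)%g) invMg col_groupM ?col_groupV. Qed.

Lemma tperm_row_group p (la : p.-tuple 'I_p.+1) t u :
  row_of la t = row_of la u -> tperm t u \in row_group la.
Proof. by move=> e; apply/row_groupP => v; case: tpermP => // ->. Qed.

Lemma tperm_col_group p (la : p.-tuple 'I_p.+1) t u :
  col_of la t = col_of la u -> tperm t u \in col_group la.
Proof. by move=> e; apply/col_groupP => v; case: tpermP => // ->. Qed.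

Lemma SymM p n (rG : mx_representation algC (Defs.Sym p) n) (s t : 'S_p) :
  rG (s * t)%g = rG s *m rG t.
Proof. by rewrite repr_mxM ?inE. Qed.

Lemma row_sumM p (la : p.-tuple 'I_p.+1) n (rG : mx_representation algC (Defs.Sym p) n) (r : 'S_p) :
  r \in row_group la -> row_sum la rG *m rG r = row_sum la rG.
Proof.
move=> hr; rewrite /row_sum mulmx_suml [RHS](reindex_inj (mulIg r)).
by apply: eq_big => s; rewrite ?row_groupM // SymM.
Qed.

Lemma sign_permM p (s t : 'S_p) :
  (-1) ^+ odd_perm (s * t)%g = (-1) ^+ odd_perm s * (-1) ^+ odd_perm t :> algC.
Proof. by rewrite odd_permM signr_addb. Qed.

Lemma col_altM p (la : p.-tuple 'I_p.+1) n (rG : mx_representation algC (Defs.Sym p) n) (h : 'S_p) :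
  h \in col_group la -> rG h *m col_alt la rG = (-1) ^+ odd_perm h *: col_alt la rG.
Proof.
move=> hh; rewrite /col_alt mulmx_sumr [in RHS](reindex_inj (mulgI h)) scaler_sumr.
apply: eq_big => s; rewrite ?col_groupMl // => _.
by rewrite -scalemxAr -SymM scalerA sign_permM mulrA -expr2 sqrr_sign mul1r.
Qed.

Lemma col_altMr p (la : p.-tuple 'I_p.+1) n (rG : mx_representation algC (Defs.Sym p) n) (h : 'S_p) :
  h \in col_group la -> col_alt la rG *m rG h = (-1) ^+ odd_perm h *: col_alt la rG.
Proof.
move=> hh; rewrite /col_alt mulmx_suml [in RHS](reindex_inj (mulIg h)) scaler_sumr.
apply: eq_big => s; rewrite ?col_groupM // => _.
by rewrite -scalemxAl -SymM scalerA sign_permM mulrCA -expr2 sqrr_sign mulr1.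
Qed.

Lemma eq_opp0 n m (A : 'M[algC]_(m, n)) : A = - A -> A = 0.
Proof.
move=> e; have /eqP : 2%:R *: A = 0 by rewrite scaler_nat mulr2n {2}e subrr.
by rewrite scaler_eq0 pnatr_eq0 => /eqP.
Qed.

Lemma partition_eq p (la mu : p.-tuple 'I_p.+1) (s : 'S_p) :
  is_partition la -> is_partition mu ->
  (forall t, row_of mu (s t) = row_of la t) -> la = mu.
Proof.
move=> hla hmu h; apply: eq_from_tnth => i; apply: val_inj => /=.
rewrite -!card_row // -[RHS](card_preimset _ (@perm_inj _ s)).
by apply: eq_card => t; rewrite !inE h.
Qed.

(* Either two cells of one row of la are sent into one column of mu, and the
   transposition of these cells shows that the product equals its opposite, or
   the rows of la, transported by x, are distinct along the columns of mu. *)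
Lemma row_col_sandwich p (la mu : p.-tuple 'I_p.+1) (x : 'S_p) :
  is_partition la -> is_partition mu ->
  (\sum_t row_of la t <= \sum_t row_of mu t)%N ->
  (forall n (rG : mx_representation algC (Defs.Sym p) n),
      row_sum la rG *m rG x *m col_alt mu rG = 0)
  \/ (la = mu /\ exists e : algC, forall n (rG : mx_representation algC (Defs.Sym p) n),
      row_sum la rG *m rG x *m col_alt mu rG = e *: (row_sum la rG *m col_alt mu rG)).
Proof.
move=> hla hmu le_sum.
case: (pickP (fun tu : 'I_p * 'I_p => [&& tu.1 != tu.2, row_of la tu.1 == row_of la tu.2
     & col_of mu (x tu.1) == col_of mu (x tu.2)])) => [[t u] /and3P[/= ntu /eqP rtu /eqP ctu]|no].
  left => n rG; apply: eq_opp0.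
  rewrite -{1}(row_sumM rG (tperm_row_group rtu)) -(mulmxA (row_sum _ _)) -SymM.
  rewrite conjgC tpermJ SymM !mulmxA -(mulmxA _ (rG (tperm _ _))).
  rewrite (col_altM rG (tperm_col_group ctu)) odd_tperm (inj_eq perm_inj) ntu.
  by rewrite expr1 scaleN1r mulmxN.
right; pose U y := row_of la (x^-1%g y).
have injU t u : col_of mu t = col_of mu u -> U t = U u -> t = u.
  rewrite /U => ctu rtu; apply: (@perm_inj _ x^-1%g); apply/eqP; apply: contraFT (no (x^-1%g t, x^-1%g u)).
  by move=> /= ->; rewrite !permKV rtu ctu !eqxx.
have sumU : (\sum_t U t = \sum_t row_of la t)%N.
  by rewrite [RHS](reindex_inj (@perm_inj _ x^-1%g)).
have [h hC hU] : exists2 h : 'S_p, h \in col_group mu & forall t, row_of mu (h t) = U t.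
  by apply: col_sort => //; rewrite sumU.
have xh t : row_of mu ((x * h)%g t) = row_of la t by rewrite permM hU /U permK.
have e := partition_eq hla hmu xh; split=> //; subst mu.
have xhR : (x * h)%g \in row_group la by apply/row_groupP.
exists ((-1) ^+ odd_perm h^-1%g) => n rG.
rewrite -[x](mulgK h) SymM mulmxA row_sumM // -mulmxA col_altM ?col_groupV //.
by rewrite scalemxAr.
Qed.

(** * Young symmetrizers and the Specht characters *)

(** Swapping the two factors of the rank factorization of [M] gives [c] times the identity of size
    [\rank M], with the same trace. *)
Lemma quasi_idem_trace (F : fieldType) n (M : 'M[F]_n) (c : F) :
  M *m M = c *: M -> \tr M = c * (\rank M)%:R.
Proof.
move=> MM; have e : row_base M *m col_base M = c%:M.
  apply: (row_free_inj (row_base_free M)); apply: (row_full_inj (col_base_full M)).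
  by rewrite mul_scalar_mx -scalemxAr mulmx_base -mulmxA mulmxA !mulmx_base MM.
by rewrite -[M in LHS]mulmx_base mxtrace_mulC e mxtrace_scalar mulr_natr.
Qed.

Lemma trace_submod_proj (F : fieldType) (gT : finGroupType) (G : {group gT}) n
    (rG : mx_representation F G n) (U E : 'M[F]_n) (modU : mxmodule rG U) x :
  x \in G -> (E <= U)%MS -> U *m E = U -> \tr (submod_repr modU x) = \tr (E *m rG x).
Proof.
move=> Gx sEU UE; set S := submod_repr modU x.
pose B := val_submod (U := U) 1%:M; pose P := in_submod U E.
have PB : P *m B = E by rewrite -val_submodE in_submodK.
have BE : B *m E = B.
  have /submxP[X ->] : (B <= U)%MS by apply: val_submodP.
  by rewrite -mulmxA UE.
have BP : B *m P = 1%:M.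
  by apply: (@val_submod_inj _ _ U); rewrite val_submodE -mulmxA PB BE -/B.
have BS : B *m rG x = S *m B.
  by rewrite -val_submodE -[X in val_submod X]mul1mx val_submodJ.
by rewrite -PB -mulmxA BS [RHS]mxtrace_mulC -mulmxA BP mulmx1.
Qed.

Definition young p (la : p.-tuple 'I_p.+1) n (rG : mx_representation algC (Defs.Sym p) n) :=
  row_sum la rG *m col_alt la rG.

Definition ycoef p (la : p.-tuple 'I_p.+1) (y : 'S_p) : algC :=
  \sum_(g in row_group la) \sum_(h in col_group la)
    (-1) ^+ odd_perm h * ((g * h)%g == y)%:R.

Lemma sum_delta_scale (V : lmodType algC) (I : finType) (a : algC) (i : I) (f : I -> V) :
  a *: f i = \sum_j (a * (i == j)%:R) *: f j.
Proof.
rewrite (bigD1 i) //= eqxx mulr1 big1 ?addr0 // => j /negPf.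
by rewrite eq_sym => ->; rewrite mulr0 scale0r.
Qed.

Lemma ycoef_sum p (la : p.-tuple 'I_p.+1) (V : lmodType algC) (f : 'S_p -> V) :
  \sum_(g in row_group la) \sum_(h in col_group la) (-1) ^+ odd_perm h *: f (g * h)%g
  = \sum_y ycoef la y *: f y.
Proof.
under eq_bigr do under eq_bigr do rewrite sum_delta_scale.
under eq_bigr do rewrite exchange_big.
rewrite exchange_big; apply: eq_bigr => y _.
by rewrite scaler_suml; apply: eq_bigr => g _; rewrite scaler_suml.
Qed.

Lemma young_ycoef p (la : p.-tuple 'I_p.+1) n (rG : mx_representation algC (Defs.Sym p) n) :
  young la rG = \sum_y ycoef la y *: rG y.
Proof.
rewrite -ycoef_sum /young /row_sum mulmx_suml; apply: eq_bigr => g _.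
rewrite /col_alt mulmx_sumr; apply: eq_bigr => h _.
by rewrite -scalemxAr SymM.
Qed.

(** A permutation that preserves rows and columns fixes every cell, so 1 = g h only for g = h = 1.
    This gives c the trace p! in the regular representation. *)
Lemma ycoef1 p (la : p.-tuple 'I_p.+1) : is_partition la -> ycoef la 1%g = 1.
Proof.
move=> hla; have one_R : 1%g \in row_group la by apply/row_groupP => t; rewrite perm1.
have one_C : 1%g \in col_group la by apply/col_groupP => t; rewrite perm1.
have triv g h : g \in row_group la -> h \in col_group la -> (g * h)%g = 1%g -> g = 1%g.
  move=> /row_groupP gR hC gh; have /col_groupP gC : g \in col_group la.
    by rewrite -col_groupV (_ : g^-1 = h)%g //; apply/eqP; rewrite eq_invg_mul gh.
  by apply/permP => t; rewrite perm1; apply: cell_inj hla (gR t) (gC t).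
rewrite /ycoef (bigD1 1%g) //= (bigD1 1%g) //= mulg1 eqxx odd_perm1 mulr1 expr0.
rewrite !big1 ?addr0 // => [g /andP[gR ng]|h /andP[hC nh]].
  rewrite big1 // => h hC; case: eqP => [e|]; rewrite ?mulr0 //.
  by rewrite (triv g h) ?eqxx // in ng.
by rewrite mul1g (negPf nh) mulr0.
Qed.

(** Expanding the middle b_la x a_mu of a_la b_la x a_mu b_mu leaves terms a_la y b_mu, which
    [row_col_sandwich] evaluates. *)
Lemma young_sandwich p (la mu : p.-tuple 'I_p.+1) n
    (rG : mx_representation algC (Defs.Sym p) n) x :
  young la rG *m rG x *m young mu rG =
  \sum_(h in col_group la) \sum_(r in row_group mu)
    (-1) ^+ odd_perm h *: (row_sum la rG *m rG (h * x * r)%g *m col_alt mu rG).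
Proof.
have mid : col_alt la rG *m rG x *m row_sum mu rG =
    \sum_(h in col_group la) \sum_(r in row_group mu) (-1) ^+ odd_perm h *: rG (h * x * r)%g.
  rewrite /col_alt mulmx_suml mulmx_suml; apply: eq_bigr => h _.
  rewrite /row_sum mulmx_sumr; apply: eq_bigr => r _.
  by rewrite -!scalemxAl !SymM.
have expand (A B : 'M_n) : A *m (\sum_(h in col_group la) \sum_(r in row_group mu)
      (-1) ^+ odd_perm h *: rG (h * x * r)%g) *m B =
    \sum_(h in col_group la) \sum_(r in row_group mu)
      (-1) ^+ odd_perm h *: (A *m rG (h * x * r)%g *m B).
  rewrite mulmx_sumr mulmx_suml; apply: eq_bigr => h _.
  rewrite mulmx_sumr mulmx_suml; apply: eq_bigr => r _.
  by rewrite -scalemxAr -scalemxAl.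
transitivity (row_sum la rG *m (col_alt la rG *m rG x *m row_sum mu rG) *m col_alt mu rG).
  by rewrite /young !mulmxA.
by rewrite mid expand.
Qed.

(** Von Neumann's lemma, with [tau] chosen uniformly in the representation. *)
Lemma young_conj p (la : p.-tuple 'I_p.+1) : is_partition la ->
  exists tau : 'S_p -> algC, forall x n (rG : mx_representation algC (Defs.Sym p) n),
    young la rG *m rG x *m young la rG = tau x *: young la rG.
Proof.
move=> hla.
have [e he] : exists e : 'S_p -> algC, forall x n (rG : mx_representation algC (Defs.Sym p) n),
    row_sum la rG *m rG x *m col_alt la rG = e x *: young la rG.
  apply: (fin_all_exists (P := fun x a => forall n (rG : mx_representation algC (Defs.Sym p) n),
    row_sum la rG *m rG x *m col_alt la rG = a *: young la rG)) => x.
  have [h|[_ [a h]]] := row_col_sandwich x hla hla (leqnn _); last by exists a.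
  by exists 0 => n rG; rewrite scale0r.
exists (fun x => \sum_(h in col_group la) \sum_(r in row_group la)
                   (-1) ^+ odd_perm h * e (h * x * r)%g) => x n rG.
rewrite young_sandwich scaler_suml; apply: eq_bigr => h _.
by rewrite scaler_suml; apply: eq_bigr => r _; rewrite he scalerA.
Qed.

Lemma young_quasi_idem p (la : p.-tuple 'I_p.+1) : is_partition la ->
  exists c : algC, forall n (rG : mx_representation algC (Defs.Sym p) n),
    young la rG *m young la rG = c *: young la rG.
Proof.
move=> hla; have [tau h] := young_conj hla; exists (tau 1%g) => n rG.
by rewrite -h repr_mx1 mulmx1.
Qed.

Lemma trace_regular p (y : 'S_p) :
  \tr (regular_repr algC (Defs.Sym p) y) = p`!%:R *+ (y == 1%g).
Proof.
have := cfReprReg (Defs.Sym p) => /(congr1 (fun f : 'CF(_) => f y)).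
by rewrite cfunE cfRegE inE mulr1n => ->; rewrite /= cardsT card_Sn.
Qed.

Lemma young_trace_regular p (la : p.-tuple 'I_p.+1) (x : 'S_p) :
  \tr (young la (regular_repr algC (Defs.Sym p)) *m regular_repr algC (Defs.Sym p) x^-1%g)
  = p`!%:R * ycoef la x.
Proof.
rewrite young_ycoef mulmx_suml raddf_sum (bigD1 x) //= big1 => [|y nyx].
  by rewrite -scalemxAl -SymM mulgV mxtraceZ trace_regular eqxx addr0 mulrC.
rewrite -scalemxAl -SymM mxtraceZ trace_regular -eq_mulgV1.
by rewrite (negPf nyx) mulr0n mulr0.
Qed.

(** The trace of the symmetrizer in the regular representation is both p! and c times its rank; so c
    is p! over the rank, nonzero and rational. *)
Lemma young_scalar p (la : p.-tuple 'I_p.+1) : is_partition la ->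
  exists c : algC, [/\ c != 0, c^* = c & forall n (rG : mx_representation algC (Defs.Sym p) n),
    young la rG *m young la rG = c *: young la rG].
Proof.
move=> hla; have [c hc] := young_quasi_idem hla; exists c.
have := quasi_idem_trace (hc _ (regular_repr algC (Defs.Sym p))).
have := young_trace_regular la 1%g; rewrite invg1 repr_mx1 mulmx1 ycoef1 // mulr1 => -> e.
have c0 : c != 0.
  by apply/eqP => c0; move/eqP: e; rewrite c0 mul0r pnatr_eq0 eqn0Ngt fact_gt0.
split => //; set r := (\rank _)%:R in e.
have r0 : r != 0.
  by apply/eqP => r0; move/eqP: e; rewrite r0 mulr0 pnatr_eq0 eqn0Ngt fact_gt0.
by rewrite -[c](mulfK r0) -e rmorphM fmorphV /= !conjC_nat.
Qed.

(* Left multiplication by c / gamma projects the regular module onto the Specht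
   module and commutes with right multiplication by s. *)
Lemma chi_formula p (la : p.-tuple 'I_p.+1) (c : algC) (s : 'S_p) : c != 0 ->
  (forall n (rG : mx_representation algC (Defs.Sym p) n),
    young la rG *m young la rG = c *: young la rG) ->
  chi la s = c^-1 * \sum_x ycoef la (x * s^-1 * x^-1)%g.
Proof.
move=> c0 hc; rewrite /chi cfunE inE mulr1n.
set aG := regular_repr algC (Defs.Sym p).
set v := young_sym la.
have vE y : v *m aG y = \sum_z ycoef la z *: delta_mx 0 (gring_index (Defs.Sym p) (z * y)%g).
  rewrite /v /young_sym (ycoef_sum la (fun z => delta_mx 0 (gring_index (Defs.Sym p) z))).
  rewrite mulmx_suml; apply: eq_bigr => z _; rewrite -scalemxAl -rowE rowK.
  by rewrite gring_indexK ?inE.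
pose E := c^-1 *: \matrix_i (v *m aG (enum_val i)) : 'M_(gcard (Defs.Sym p)).
have EJ g : aG g *m E = E *m aG g.
  apply/row_matrixP => i; rewrite !row_mul rowK -rowE /E !linearZ /= !rowK.
  by rewrite -scalemxAl -mulmxA -SymM gring_indexK ?inE.
have vc : v = delta_mx 0 (gring_index (Defs.Sym p) 1%g) *m young la aG.
  rewrite young_ycoef mulmx_sumr -[LHS]mulmx1 -(repr_mx1 aG) vE; apply: eq_bigr => z _.
  by rewrite -scalemxAr -rowE rowK gring_indexK ?inE // mulg1 mul1g.
have vEv : v *m E = v.
  have -> : v *m E = c^-1 *: (v *m young la aG).
    rewrite /E -scalemxAr; congr (_ *: _); rewrite {1}/v /young_sym.
    rewrite (ycoef_sum la (fun z => delta_mx 0 (gring_index (Defs.Sym p) z))).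
    rewrite mulmx_suml young_ycoef mulmx_sumr; apply: eq_bigr => z _.
    by rewrite -scalemxAl -rowE rowK gring_indexK ?inE // -scalemxAr.
  by rewrite {1}vc -mulmxA hc -scalemxAr -vc scalerA mulVf // scale1r.
rewrite (trace_submod_proj (E := E)) ?inE //; first last.
- apply/row_matrixP => i; rewrite row_mul.
  have /cyclic_mxP[A EA ->] := row_sub i (cyclic_mx aG v).
  have AE : A *m E = E *m A.
    have [a ->] := envelop_mxP EA; rewrite mulmx_suml mulmx_sumr; apply: eq_bigr => x _.
    by rewrite -scalemxAl EJ scalemxAr.
  by rewrite -mulmxA AE mulmxA vEv.
- apply: scalemx_sub; apply/row_subP => i; rewrite rowK.
  apply: mxmodule_trans (cyclic_mx_module _ _) _ (cyclic_mx_id _ _).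
  by rewrite inE.
rewrite /E -scalemxAl mxtraceZ; congr (_ * _).
have -> : \sum_x ycoef la (x * s^-1 * x^-1)%g =
    \sum_(x in Defs.Sym p) ycoef la (x * s^-1 * x^-1)%g.
  by apply: eq_bigl => x; rewrite inE.
rewrite /mxtrace [RHS]big_enum_val; apply: eq_bigr => i _.
have -> (M : 'M[algC]_(gcard (Defs.Sym p))) : M i i = (row i M) 0 i by rewrite mxE.
rewrite row_mul rowK -mulmxA -SymM vE summxE.
(* The diagonal entry at a group element x is the coefficient of x in the product of the symmetrizer
   with x s, which comes from z = x s^-1 x^-1 alone. *)
rewrite (bigD1 (enum_val i * s^-1 * (enum_val i)^-1)%g) //= big1 => [|z nz].
  by rewrite !mxE !eqxx !mulgA !mulgKV gring_valK eqxx mulr1 addr0.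
rewrite !mxE eqxx /= -[i in i == _]gring_valK (inj_in_eq (can_in_inj (@gring_indexK _ _))) ?inE //.
case: eqP => [e|]; last by rewrite mulr0.
by rewrite -(inj_eq (mulIg (enum_val i * s)%g)) -e !mulgA !mulgKV eqxx in nz.
Qed.

(** * Orthonormality of the Specht characters *)

Lemma chi_char p (la : p.-tuple 'I_p.+1) : chi la \is a character.
Proof. exact: cfRepr_char. Qed.

Lemma factC_neq0 p : p`!%:R != 0 :> algC.
Proof. by rewrite pnatr_eq0 eqn0Ngt fact_gt0. Qed.

Lemma card_SymG p : #|Defs.Sym p| = p`!.
Proof. by rewrite cardsT card_Sn. Qed.

(** Since [phi] is a class function, each conjugate in [chi_formula] contributes the same sum, and
    their number p! cancels the normalization of the inner product. *)
Lemma cfdot_chi p (la : p.-tuple 'I_p.+1) (c : algC) (phi : 'CF(Defs.Sym p)) : c != 0 ->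
  (forall n (rG : mx_representation algC (Defs.Sym p) n),
    young la rG *m young la rG = c *: young la rG) ->
  '[phi, chi la] = c^-1 * \sum_g phi g * ycoef la g.
Proof.
move=> c0 hc; rewrite cfdotE.
rewrite (eq_bigr (fun x => c^-1 * \sum_y phi x * ycoef la (y * x * y^-1)%g)); last first.
  move=> x _; rewrite -char_inv ?chi_char // (chi_formula _ c0 hc) mulrCA; congr (_ * _).
  by rewrite mulr_sumr; apply: eq_bigr => y _; rewrite invgK.
rewrite -mulr_sumr exchange_big mulrCA; congr (_ * _).
rewrite (eq_bigr (fun=> \sum_g phi g * ycoef la g)) => [|y _].
  by rewrite sumr_const card_SymG card_Sn -[X in _ * X]mulr_natl mulKf ?factC_neq0.
rewrite (reindex_inj (conjg_inj y)) /=; apply: eq_big => [x|x _]; first by rewrite inE.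
by rewrite cfunJ ?inE // conjgE !mulgA mulgV mul1g mulgK.
Qed.

(** Multiplied by gamma, both sides are the trace of the symmetrizer in [rG]. *)
Lemma cfdot_repr_chi p (la : p.-tuple 'I_p.+1) n (rG : mx_representation algC (Defs.Sym p) n) :
  is_partition la -> '[cfRepr rG, chi la] = (\rank (young la rG))%:R.
Proof.
move=> hla; have [c [c0 _ hc]] := young_scalar hla; rewrite (cfdot_chi _ c0 hc).
apply: (canLR (mulKf c0)); rewrite -(quasi_idem_trace (hc _ rG)) young_ycoef raddf_sum.
by apply: eq_bigr => g _; rewrite /= mxtraceZ cfunE inE mulr1n mulrC.
Qed.

(** Traces in the regular representation read off coefficients, so the inner product is expressed
    through the products c_la x c_mu, where the sandwich lemmas apply. *)
Lemma cfdot_chi_chi p (la mu : p.-tuple 'I_p.+1) (c d : algC) : c != 0 -> d != 0 ->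
  (forall n (rG : mx_representation algC (Defs.Sym p) n),
    young la rG *m young la rG = c *: young la rG) ->
  (forall n (rG : mx_representation algC (Defs.Sym p) n),
    young mu rG *m young mu rG = d *: young mu rG) ->
  let aG := regular_repr algC (Defs.Sym p) in
  '[chi la, chi mu] = (c * d * p`!%:R)^-1 *
     \sum_x \tr (young la aG *m aG x *m young mu aG *m aG x^-1%g).
Proof.
move=> c0 d0 hc hd aG; rewrite (cfdot_chi _ d0 hd).
rewrite (eq_bigr (fun g => c^-1 * \sum_x ycoef la (x * g^-1 * x^-1)%g * ycoef mu g)); last first.
  by move=> g _; rewrite (chi_formula _ c0 hc) -mulrA mulr_suml.
rewrite -mulr_sumr exchange_big !invfM -!mulrA mulrCA; congr (_ * (_ * _)).
rewrite mulr_sumr; apply: eq_bigr => x _; apply: (canRL (mulKf (factC_neq0 p))).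
rewrite [young mu _]young_ycoef mulmx_sumr mulmx_suml raddf_sum mulr_sumr.
apply: eq_bigr => g _; rewrite mulrA -young_trace_regular -/aG.
rewrite !invMg !invgK mulgA !SymM -scalemxAr -scalemxAl /= mxtraceZ mulrC.
by rewrite !mulmxA.
Qed.

Lemma chi_norm1 p (la : p.-tuple 'I_p.+1) : is_partition la -> '[chi la] = 1.
Proof.
move=> hla; have [c [c0 _ hc]] := young_scalar hla; have [tau htau] := young_conj hla.
rewrite (cfdot_chi_chi c0 c0 hc hc); set aG := regular_repr _ _.
have trY : \tr (young la aG) = p`!%:R.
  by have := young_trace_regular la 1%g; rewrite invg1 repr_mx1 mulmx1 ycoef1 // mulr1.
(* The cube of the symmetrizer is evaluated twice: as c^2 times it, and by expanding the middle
   factor and applying [htau]. Taking traces compares the scalars. *)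
have e : \sum_x ycoef la x * tau x = c * c.
  have cube : (c * c) *: young la aG = \sum_x (ycoef la x * tau x) *: young la aG.
    rewrite -scalerA -hc scalemxAl -hc.
    rewrite {2}young_ycoef mulmx_sumr mulmx_suml; apply: eq_bigr => x _.
    by rewrite -scalemxAr -scalemxAl htau scalerA.
  apply: (mulIf (factC_neq0 p)); rewrite -trY -[RHS]mxtraceZ cube raddf_sum mulr_suml.
  by apply: eq_bigr => x _; rewrite /= mxtraceZ.
rewrite (eq_bigr (fun x => p`!%:R * (ycoef la x * tau x))) => [|x _].
  by rewrite -mulr_sumr e [X in _ * X]mulrC mulVf ?mulf_neq0 ?factC_neq0.
by rewrite htau -scalemxAl mxtraceZ young_trace_regular mulrCA (mulrC (tau x)).
Qed.

Lemma chi_ortho p (la mu : p.-tuple 'I_p.+1) :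
  is_partition la -> is_partition mu -> la != mu -> '[chi la, chi mu] = 0.
Proof.
wlog le_sum : la mu / (\sum_t row_of la t <= \sum_t row_of mu t)%N => [IH hla hmu nlm|].
  have [le_sum|/ltnW le_sum] := leqP (\sum_t row_of la t) (\sum_t row_of mu t).
    exact: IH.
  by rewrite cfdotC (IH mu la) ?conjC0 // eq_sym.
move=> hla hmu nlm; have [c [c0 _ hc]] := young_scalar hla; have [d [d0 _ hd]] := young_scalar hmu.
rewrite (cfdot_chi_chi c0 d0 hc hd) big1 ?mulr0 // => x _.
rewrite young_sandwich big1 ?mul0mx ?mxtrace0 // => h _; apply: big1 => r _.
have [->|[e]] := row_col_sandwich (h * x * r)%g hla hmu le_sum; first by rewrite scaler0.
by rewrite e eqxx in nlm.
Qed.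

Lemma chi_real p (la : p.-tuple 'I_p.+1) s : is_partition la -> chi la s \is Num.real.
Proof.
move=> hla; have [c [c0 cR hc]] := young_scalar hla; rewrite (chi_formula _ c0 hc).
rewrite rpredM ?rpredV ?CrealE ?cR // rmorph_sum; apply/eqP/eq_bigr => x _.
rewrite /ycoef rmorph_sum; apply: eq_bigr => g _; rewrite rmorph_sum; apply: eq_bigr => h _.
by rewrite rmorphM rmorph_sign rmorph_nat.
Qed.

(** * Semistandard tableaux: lower bound for the rank *)

Lemma sum_tperm_gt (T : finType) (w f : T -> nat) t u :
  (w t < w u)%N -> (f u < f t)%N ->
  (\sum_v w v * f v < \sum_v w v * f (tperm t u v))%N.
Proof.
move=> lt_w lt_f; have ntu : u != t by apply: contraTneq lt_w => ->; rewrite ltnn.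
rewrite (bigD1 t) // (bigD1 u) //= [X in (_ < X)%N](bigD1 t) // [X in (_ < _ + X)%N](bigD1 u) //=.
rewrite tpermL tpermR !addnA.
rewrite (eq_bigr (fun i => w i * f (tperm t u i))%N) => [|i /andP[nt nu]]; last first.
  by rewrite tpermD // eq_sym.
rewrite ltn_add2r; nia.
Qed.

Definition sorted_on (T : finType) (c w f : T -> nat) :=
  forall t u, c t = c u -> (w t < w u)%N -> (f t <= f u)%N.

(** If g t < f t, every u with f u <= g t precedes t, hence has g u <= g t; as t itself also has g t
    <= g t, the counts differ. Applied in both directions it gives equality. *)
Lemma sorted_le (T : finType) (c w f g : T -> nat) :
  (forall t u, c t = c u -> w t = w u -> t = u) -> sorted_on c w f -> sorted_on c w g ->
  (forall t v, #|[set u | (c u == c t) && (f u <= v)%N]|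
             = #|[set u | (c u == c t) && (g u <= v)%N]|) ->
  forall t, (f t <= g t)%N.
Proof.
move=> inj sf sg cnt t; rewrite leqNgt; apply/negP => lt_gf.
have : (#|[set u | (c u == c t) && (f u <= g t)%N]|
        < #|[set u | (c u == c t) && (g u <= g t)%N]|)%N.
  apply: proper_card; apply/properP; split; last first.
    by exists t; rewrite !inE eqxx //= -ltnNge.
  apply/subsetP => u; rewrite !inE => /andP[/eqP cu le_f]; rewrite cu eqxx /=.
  case: (ltngtP (w u) (w t)) => [lt_w|lt_w|/(inj _ _ cu) ->] //; first exact: sg.
  by have := sf _ _ (esym cu) lt_w; lia.
by rewrite cnt ltnn.
Qed.

(* A maximizer of sum_t w t * U (s t) is sorted, since otherwise a transposition
   improves it, and U has only one sorted rearrangement. *)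
Lemma rearrangement (T : finType) (c w U : T -> nat) (s : {perm T}) :
  (forall t u, c t = c u -> w t = w u -> t = u) ->
  (forall t, c (s t) = c t) ->
  (forall t u, c t = c u -> (w t < w u)%N -> (U t <= U u)%N) ->
  (\sum_t w t * U (s t) <= \sum_t w t * U t)%N /\
  ((\sum_t w t * U (s t) = \sum_t w t * U t)%N -> forall t, U (s t) = U t).
Proof.
move=> inj cs sU; pose Psi (s : {perm T}) := (\sum_t w t * U (s t))%N.
pose P (s : {perm T}) := [forall t, c (s t) == c t].
have uniq_sorted (r : {perm T}) : P r -> sorted_on c w (U \o r) -> forall t, U (r t) = U t.
  move=> /forallP Pr sr t.
  have cnt x v : #|[set u | (c u == c x) && (U (r u) <= v)%N]|
             = #|[set u | (c u == c x) && (U u <= v)%N]|.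
    rewrite -[RHS](card_preimset _ (@perm_inj _ r)); apply: eq_card => u.
    by rewrite !inE (eqP (Pr u)).
  apply/eqP; rewrite eqn_leq (sorted_le (f := U \o r) inj sr sU cnt).
  by rewrite (sorted_le (g := U \o r) inj sU sr) // => x v; rewrite cnt.
have improve (r : {perm T}) : P r -> (forall r', P r' -> (Psi r' <= Psi r)%N) ->
    forall t, U (r t) = U t.
  move=> Pr max_r; apply: uniq_sorted => // t u ctu lt_w; rewrite leqNgt; apply/negP => /= lt_U.
  have := sum_tperm_gt (f := U \o r) lt_w lt_U; rewrite ltnNge => /negP; apply.
  have -> : (\sum_v w v * (U \o r) (tperm t u v) = Psi (tperm t u * r)%g)%N.
    by apply: eq_bigr => v _; rewrite /= permM.
  apply: max_r; apply/forallP => v; rewrite permM (eqP (forallP Pr _)).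
  by case: tpermP => // ->; rewrite ctu.
have P1 : P 1%g by apply/forallP => t; rewrite perm1.
have [r Pr max_r] := arg_maxnP Psi P1.
have Psi_r : Psi r = (\sum_t w t * U t)%N.
  by apply: eq_bigr => t _; rewrite improve.
have Ps : P s by apply/forallP => t; rewrite cs.
split=> [|e]; first by rewrite -Psi_r; apply: max_r.
by apply: improve => // r' /max_r; rewrite Psi_r -e.
Qed.

(** The inverse makes this a right action, as matrices acting on row vectors require. *)
Definition fun_act p n (f : {ffun 'I_p -> 'I_n}) (s : 'S_p) : {ffun 'I_p -> 'I_n} :=
  [ffun t => f (s^-1%g t)].

Lemma fun_act1 p n (f : {ffun 'I_p -> 'I_n}) : fun_act f 1%g = f.
Proof. by apply/ffunP => t; rewrite ffunE invg1 perm1. Qed.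

Lemma fun_actM p n (f : {ffun 'I_p -> 'I_n}) s t : fun_act f (s * t)%g = fun_act (fun_act f s) t.
Proof. by apply/ffunP => x; rewrite !ffunE invMg permM. Qed.

Definition fun_mx p n (s : 'S_p) : 'M[algC]_#|{ffun 'I_p -> 'I_n}| :=
  \matrix_i delta_mx 0 (enum_rank (fun_act (enum_val i) s)).

Lemma fun_mx_repr p n : mx_repr (Defs.Sym p) (@fun_mx p n).
Proof.
split=> [|s t _ _]; apply/row_matrixP => i; rewrite ?row_mul !rowK.
  by rewrite fun_act1 enum_valK row1.
by rewrite -rowE rowK enum_rankK fun_actM.
Qed.

Definition fun_repr p n := MxRepresentation (fun_mx_repr p n).

Definition ssyt p (la : p.-tuple 'I_p.+1) n :=
  [set T : {ffun 'I_p -> 'I_n} |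
     [forall t : 'I_p, forall u : 'I_p,
        ((row_of la t == row_of la u) && (col_of la t < col_of la u)%N
           ==> (T t <= T u)%N)
        && ((col_of la t == col_of la u) && (row_of la t < row_of la u)%N
           ==> (T t < T u)%N)]].

Lemma ssytP p (la : p.-tuple 'I_p.+1) n (T : {ffun 'I_p -> 'I_n}) :
  reflect ((forall t u, row_of la t = row_of la u -> (col_of la t < col_of la u)%N -> (T t <= T u)%N)
    /\ (forall t u, col_of la t = col_of la u -> (row_of la t < row_of la u)%N -> (T t < T u)%N))
    (T \in ssyt la n).
Proof.
rewrite inE; apply: (iffP forallP) => [h|[h1 h2] t].
  split=> t u e lt_tu; have /andP[/implyP h1 /implyP h2] := forallP (h t) u.
    by apply: h1; rewrite e eqxx.
  by apply: h2; rewrite e eqxx.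
by apply/forallP => u; apply/andP; split; apply/implyP => /andP[/eqP]; [apply: h1|apply: h2].
Qed.

Lemma young_funE p (la : p.-tuple 'I_p.+1) n (T U : {ffun 'I_p -> 'I_n}) :
  young la (fun_repr p n) (enum_rank T) (enum_rank U) =
  \sum_(r in row_group la) \sum_(h in col_group la)
     (-1) ^+ odd_perm h * (fun_act T (r * h)%g == U)%:R.
Proof.
rewrite /young /row_sum /col_alt mulmx_suml summxE; apply: eq_bigr => r _.
rewrite mulmx_sumr summxE; apply: eq_bigr => h _.
rewrite -scalemxAr -SymM !mxE; congr (_ * _).
by rewrite enum_rankK (inj_eq enum_rank_inj) eq_sym eqxx.
Qed.

(** Invariant under the row group, while among the rearrangements of a semistandard tableau within
    its columns only the tableau itself attains the maximum. This orders the tableaux for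
    triangularity. *)
Definition row_weight p (la : p.-tuple 'I_p.+1) n (T : {ffun 'I_p -> 'I_n}) :=
  (\sum_t row_of la t * T t)%N.

Definition col_weight p (la : p.-tuple 'I_p.+1) n (T : {ffun 'I_p -> 'I_n}) :=
  (\sum_t col_of la t * T t)%N.

Lemma row_weight_row p (la : p.-tuple 'I_p.+1) n (T : {ffun 'I_p -> 'I_n}) r :
  r \in row_group la -> row_weight la (fun_act T r) = row_weight la T.
Proof.
move=> /row_groupP rR; rewrite /row_weight (reindex_inj (@perm_inj _ r)).
by apply: eq_bigr => t _; rewrite ffunE permK rR.
Qed.

Lemma col_weight_col p (la : p.-tuple 'I_p.+1) n (T : {ffun 'I_p -> 'I_n}) h :
  h \in col_group la -> col_weight la (fun_act T h) = col_weight la T.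
Proof.
move=> /col_groupP hC; rewrite /col_weight (reindex_inj (@perm_inj _ h)).
by apply: eq_bigr => t _; rewrite ffunE permK hC.
Qed.

Lemma fun_act_eq p n (T U : {ffun 'I_p -> 'I_n}) s :
  (fun_act T s == U) = (T == fun_act U s^-1%g).
Proof.
by apply/eqP/eqP => [<-|->]; rewrite -fun_actM ?mulgV ?mulVg fun_act1.
Qed.

Lemma row_sorted_uniq p (la : p.-tuple 'I_p.+1) n (T U : {ffun 'I_p -> 'I_n}) r :
  is_partition la -> r \in row_group la -> T \in ssyt la n -> U \in ssyt la n ->
  fun_act T r = U -> T = U.
Proof.
move=> hla /row_groupP rR /ssytP[Tr _] /ssytP[Ur _] e.
have inj t u : row_of la t = row_of la u -> col_of la t = col_of la u -> t = u.
  exact: cell_inj.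
have TU t : T t = U (r t) by rewrite -e ffunE permK.
have rV t : row_of la (r^-1%g t) = row_of la t by rewrite -[in RHS](permKV r t) rR.
have UT t : U t = T (r^-1%g t) by rewrite TU permKV.
have [le1 eq1] := rearrangement (U := fun t => U t) inj rR Ur.
have [le2 _] := rearrangement (U := fun t => T t) inj rV Tr.
apply/ffunP => t; rewrite TU; apply/val_inj/eq1/eqP; rewrite eqn_leq le1 /=.
under eq_bigr do rewrite UT; under [X in (_ <= X)%N]eq_bigr do rewrite -TU.
exact: le2.
Qed.

(** A nonzero term has T r = U h^-1, so [U h^-1] has the row weight of [T], at least that of [U]. By
    rearrangement U h^-1 = U, and then [T] and [U] are row-sorted in one row orbit. *)
Lemma young_fun_triangular p (la : p.-tuple 'I_p.+1) n (T U : {ffun 'I_p -> 'I_n}) :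
  is_partition la -> T \in ssyt la n -> U \in ssyt la n -> T != U ->
  (row_weight la U <= row_weight la T)%N ->
  young la (fun_repr p n) (enum_rank T) (enum_rank U) = 0.
Proof.
move=> hla hT hU nTU le_UT; rewrite young_funE big1 // => r rR; apply: big1 => h hC.
case: eqP => [e|]; rewrite ?mulr0 //; case/eqP: nTU.
have e' : fun_act T r = fun_act U h^-1%g.
  by apply/eqP; rewrite -fun_act_eq -fun_actM e.
have /ssytP[_ Uc] := hU.
have inj t u : col_of la t = col_of la u -> row_of la t = row_of la u -> t = u.
  by move=> cc rr; apply: cell_inj hla rr cc.
have [le1 eq1] := rearrangement (U := fun t => U t) inj (elimT (col_groupP la h) hC)
  (fun t u c lt => ltnW (Uc t u c lt)).
have Uh : fun_act U h^-1%g = U.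
  apply/ffunP => t; rewrite ffunE invgK; apply/val_inj/eq1/eqP; rewrite eqn_leq le1 /=.
  apply: leq_trans le_UT _; rewrite -(row_weight_row T rR) e' /row_weight.
  by apply/eq_leq/eq_bigr => v _; rewrite ffunE invgK.
by apply: row_sorted_uniq rR hT hU _; rewrite // e'.
Qed.

(** The same argument leaves only h = 1, so no signs occur and nothing cancels the term r = 1. *)
Lemma young_fun_diag p (la : p.-tuple 'I_p.+1) n (T : {ffun 'I_p -> 'I_n}) :
  is_partition la -> T \in ssyt la n ->
  young la (fun_repr p n) (enum_rank T) (enum_rank T) != 0.
Proof.
move=> hla hT; rewrite young_funE.
have /ssytP[_ Tc] := hT.
have inj t u : col_of la t = col_of la u -> row_of la t = row_of la u -> t = u.
  by move=> cc rr; apply: cell_inj hla rr cc.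
have injT t u : col_of la t = col_of la u -> T t = T u -> t = u.
  move=> cc /(congr1 val) /= TT; apply: inj => //; case: (ltngtP (row_of la t) (row_of la u)) => // lt.
    by have := Tc _ _ cc lt; lia.
  by have := Tc _ _ (esym cc) lt; lia.
have h1 r h : r \in row_group la -> h \in col_group la -> fun_act T (r * h)%g = T -> h = 1%g.
  move=> rR hC e.
  have e' : fun_act T r = fun_act T h^-1%g.
    by apply/eqP; rewrite -fun_act_eq -fun_actM e.
  have [le1 eq1] := rearrangement (U := fun t => T t) inj (elimT (col_groupP la h) hC)
    (fun t u c lt => ltnW (Tc t u c lt)).
  apply/permP => t; rewrite perm1; apply: injT; first exact: (elimT (col_groupP la h) hC).
  apply/val_inj/eq1; rewrite -/(row_weight la T) -(row_weight_row T rR) e' /row_weight.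
  by apply: eq_bigr => v _; rewrite ffunE invgK.
have one_R : 1%g \in row_group la by apply/row_groupP => t; rewrite perm1.
have one_C : 1%g \in col_group la by apply/col_groupP => t; rewrite perm1.
have -> : \sum_(r in row_group la) \sum_(h in col_group la)
     (-1) ^+ odd_perm h * (fun_act T (r * h)%g == T)%:R
  = \sum_(r in row_group la) (fun_act T r == T)%:R :> algC.
  apply: eq_bigr => r rR; rewrite (bigD1 1%g) //= odd_perm1 mul1r mulg1.
  rewrite big1 ?addr0 // => h /andP[hC nh]; case: eqP => [/(h1 _ _ rR hC) e|].
    by rewrite e eqxx in nh.
  by rewrite mulr0.
by rewrite (bigD1 1%g) //= fun_act1 eqxx gt_eqF // ltr_wpDr ?ltr01 // sumr_ge0.
Qed.

Lemma rank_young_ge p (la : p.-tuple 'I_p.+1) n : is_partition la ->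
  (schur_one n la <= \rank (young la (fun_repr p n)))%N.
Proof.
move=> hla; rewrite [schur_one n la](_ : _ = #|ssyt la n|) //; set Y := young _ _.
pose f (i : 'I_#|ssyt la n|) := enum_rank (enum_val i).
have -> : #|ssyt la n| = \rank (mxsub f f Y).
  apply/esym/eqP; apply: inj_row_free => v vB.
  apply/eqP/rV0Pn => -[i0 vi0].
  (* At a tableau of least row weight in the support of [v], triangularity reduces the relation to
     the diagonal entry. *)
  have [i vi min_i] := arg_minnP (P := fun i => v 0 i != 0)
     (fun i => row_weight la (enum_val i)) vi0.
  have := congr1 (fun M : 'rV_ _ => M 0 i) vB; rewrite !mxE (bigD1 i) //= big1 => [|j nji].
    rewrite addr0 mxE => /eqP; rewrite mulf_eq0 (negPf vi) /=.
    by apply/negP/young_fun_diag => //; apply: enum_valP.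
  have [->|vj] := eqVneq (v 0 j) 0; first by rewrite mul0r.
  rewrite mxE young_fun_triangular ?mulr0 ?enum_valP //; last exact: min_i.
  by rewrite (inj_eq enum_val_inj).
rewrite mxsubrc (leq_trans (mxrankS (rowsub_sub f _))) // -mxrank_tr trmx_mxsub.
by rewrite -[leqRHS]mxrank_tr mxrankS // rowsub_sub.
Qed.

(** * Garnir relations: upper bound for the rank *)

(** Columns of the Young matrix, because the right factor [col_alt] makes them alternate along the
    columns of the diagram; transposed so that row-space inclusion applies. *)
Definition young_col p (la : p.-tuple 'I_p.+1) n (U : {ffun 'I_p -> 'I_n}) :=
  (young la (fun_repr p n) *m delta_mx (enum_rank U) (0 : 'I_1))^T.

Lemma fun_repr_delta p n (U : {ffun 'I_p -> 'I_n}) (s : 'S_p) :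
  fun_repr p n s *m delta_mx (enum_rank U) (0 : 'I_1) =
  delta_mx (enum_rank (fun_act U s^-1%g)) 0.
Proof.
rewrite -colE; apply/colP => i; rewrite !mxE eqxx /= andbT.
rewrite -{2}[i]enum_valK !(inj_eq enum_rank_inj) [U == _]eq_sym.
by rewrite fun_act_eq.
Qed.

Lemma young_col_act p (la : p.-tuple 'I_p.+1) n (U : {ffun 'I_p -> 'I_n}) (s : 'S_p) :
  young_col la (fun_act U s^-1%g) =
  (young la (fun_repr p n) *m fun_repr p n s *m delta_mx (enum_rank U) 0)^T.
Proof. by rewrite -mulmxA fun_repr_delta. Qed.

Lemma young_col_col p (la : p.-tuple 'I_p.+1) n (U : {ffun 'I_p -> 'I_n}) (h : 'S_p) :
  h \in col_group la -> young_col la (fun_act U h^-1%g) = (-1) ^+ odd_perm h *: young_col la U.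
Proof.
move=> hC; rewrite young_col_act /young -(mulmxA (row_sum _ _)) col_altMr //.
by rewrite -scalemxAr -scalemxAl linearZ.
Qed.

(** The sum runs over all permutations of [X] instead of coset representatives; the repetition is
    divided out in [young_col_garnir]. *)
Definition garnir p (X : {set 'I_p}) n (rG : mx_representation algC (Defs.Sym p) n) :=
  \sum_(w : 'S_p | perm_on X w) (-1) ^+ odd_perm w *: rG w.

Lemma garnir_tperm p (X : {set 'I_p}) n (rG : mx_representation algC (Defs.Sym p) n) x y :
  x \in X -> y \in X -> x != y -> rG (tperm x y) *m garnir X rG = - garnir X rG.
Proof.
move=> xX yX nxy; rewrite /garnir mulmx_sumr [in RHS](reindex_inj (mulgI (tperm x y))) -sumrN.
have tX : perm_on X (tperm x y).
  by apply/subsetP => z; rewrite inE; case: tpermP => [->|->|]; rewrite ?eqxx.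
apply: eq_big => w.
  apply/idP/idP => h; first exact: perm_onM.
  by rewrite -[w](mulKg (tperm x y)) tpermV; apply: perm_onM.
by move=> _; rewrite -scalemxAr -SymM -scaleNr sign_permM odd_tperm nxy expr1 mulN1r opprK.
Qed.

(** For each h, the transposition of x and y is absorbed by the row sum on the left and, carried
    through h, changes the sign of the Garnir sum on the right. *)
Lemma young_garnir p (la : p.-tuple 'I_p.+1) (X : {set 'I_p}) n
    (rG : mx_representation algC (Defs.Sym p) n) :
  (forall h, h \in col_group la -> exists x y,
     [/\ x != y, row_of la x = row_of la y, h x \in X & h y \in X]) ->
  young la rG *m garnir X rG = 0.
Proof.
move=> pig; rewrite /young -mulmxA.
have -> : col_alt la rG *m garnir X rG =
    \sum_(h in col_group la) (-1) ^+ odd_perm h *: (rG h *m garnir X rG).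
  by rewrite /col_alt mulmx_suml; apply: eq_bigr => h _; rewrite scalemxAl.
rewrite mulmx_sumr big1 // => h hC; rewrite -scalemxAr.
suff -> : row_sum la rG *m (rG h *m garnir X rG) = 0 by rewrite scaler0.
have [x [y [nxy rxy xX yX]]] := pig h hC; apply: eq_opp0.
have swap : rG (tperm x y) *m (rG h *m garnir X rG) = - (rG h *m garnir X rG).
  rewrite mulmxA -SymM conjgC tpermJ SymM -mulmxA garnir_tperm ?(inj_eq perm_inj) //.
  by rewrite mulmxN.
by rewrite -{1}(row_sumM rG (tperm_row_group rxy)) -(mulmxA (row_sum la rG)) swap mulmxN.
Qed.

(** For [t] and [u] in one row, the Garnir belt: the left column from [t] downwards and the right
    column from its top to [u]. *)
Definition garnir_set p (la : p.-tuple 'I_p.+1) (t u : 'I_p) :=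
  [set x | ((col_of la x == col_of la t) && (row_of la t <= row_of la x)%N)
        || ((col_of la x == col_of la u) && (row_of la x <= row_of la t)%N)].

Lemma card_garnir_set p (la : p.-tuple 'I_p.+1) (t u : 'I_p) : is_partition la ->
  row_of la t = row_of la u -> (col_of la t < col_of la u)%N ->
  (#|[set x | col_of la x == col_of la t]| < #|garnir_set la t u|)%N.
Proof.
move=> hla rtu ctu.
pose A := [set x | (col_of la x == col_of la t) && (row_of la t <= row_of la x)%N].
pose B := [set x | (col_of la x == col_of la u) && (row_of la x <= row_of la t)%N].
have -> : garnir_set la t u = A :|: B by apply/setP => x; rewrite !inE.
have -> : #|A :|: B| = (#|A| + #|B|)%N.
  rewrite cardsU (_ : A :&: B = set0) ?cards0 ?subn0 //; apply/setP => x; rewrite !inE.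
  by case: eqP => // ->; rewrite (ltn_eqF ctu) andbF.
pose A' := [set x | (col_of la x == col_of la t) && (row_of la x < row_of la t)%N].
have cA' : #|A'| = row_of la t by apply: row_rank.
have cB : #|B| = (row_of la t).+1.
  pose B' := [set x | (col_of la x == col_of la u) && (row_of la x < row_of la u)%N].
  have cB' : #|B'| = row_of la t by rewrite rtu; apply: row_rank.
  have -> : B = u |: B'.
    apply/setP => x; rewrite !inE rtu leq_eqVlt; case: (x =P u) => [->|nxu]; rewrite ?eqxx //=.
    case: eqP => //= cxu; case: eqP => //= rxu.
    by case: nxu; apply: cell_inj hla rxu cxu.
  by rewrite cardsU1 cB' inE ltnn andbF.
have : (#|[set x | col_of la x == col_of la t]| <= #|A| + #|A'|)%N.
  apply: leq_trans (leq_card_setU A A').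
  apply/subset_leq_card/subsetP => x; rewrite !inE => -> /=.
  by rewrite leqNgt orNb.
by rewrite cB cA'; lia.
Qed.

(** The preimage of the belt under [h] lies in the two columns, hence in the rows that the left,
    longer column meets, and it has more cells than there are such rows. *)
Lemma garnir_pigeonhole p (la : p.-tuple 'I_p.+1) (t u : 'I_p) (h : 'S_p) : is_partition la ->
  row_of la t = row_of la u -> (col_of la t < col_of la u)%N -> h \in col_group la ->
  exists x y, [/\ x != y, row_of la x = row_of la y,
    h x \in garnir_set la t u & h y \in garnir_set la t u].
Proof.
move=> hla rtu ctu /col_groupP hC; set X := garnir_set la t u.
case: (pickP (fun xy : 'I_p * 'I_p => [&& xy.1 != xy.2, row_of la xy.1 == row_of la xy.2,
     h xy.1 \in X & h xy.2 \in X])) => [[x y] /and4P[/= nxy /eqP rxy xX yX]|no].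
  by exists x, y.
have := card_garnir_set hla rtu ctu; rewrite ltnNge => /negP[].
rewrite -(card_preimset _ (@perm_inj _ h)).
apply: (card_le_bounded (f := row_of la)) => [x y|x]; rewrite !inE => hx.
  move=> hy rxy; apply/eqP; apply: contraFT (no (x, y)) => /= nxy.
  by rewrite nxy rxy eqxx !inE hx hy.
have le_c : (col_of la t <= col_of la x)%N.
  by move: hx; rewrite !hC => /orP[]/andP[/eqP-> _] //; apply: ltnW.
have [z [rz cz]] := cell_closed hla (leqnn (row_of la x)) le_c.
rewrite -rz -row_rank // cz; apply/proper_card/properP; split.
  by apply/subsetP => v; rewrite !inE => /andP[].
by exists z; rewrite !inE cz ?ltnn ?andbF.
Qed.

(* On the Garnir set, the entries of T in the right column are all smaller than
   those in the left column; hence a permutation that mixes the two columns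
   moves larger entries to the right. *)
Lemma garnir_col_weight p (la : p.-tuple 'I_p.+1) n (T : {ffun 'I_p -> 'I_n})
    (t u : 'I_p) (w : 'S_p) :
  row_of la t = row_of la u -> (col_of la t < col_of la u)%N -> (T u < T t)%N ->
  (forall x y, col_of la x = col_of la y -> (row_of la x <= row_of la y)%N -> (T x <= T y)%N) ->
  perm_on (garnir_set la t u) w -> w \notin col_group la ->
  (col_weight la T < col_weight la (fun_act T w^-1%g))%N.
Proof.
move=> rtu ctu lt_T sorted wX wC.
pose inB x := (col_of la x == col_of la u) && (row_of la x <= row_of la t)%N.
(* Twice the difference of [T x] and the threshold T t - 1/2: negative on the right part of the
   belt, positive on the left part, and never zero there. *)
pose g x : int := ((T x)%:Z - (T t)%:Z) *+ 2 + 1.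
have inX x : x \in garnir_set la t u -> ~~ inB x ->
    (col_of la x == col_of la t) && (row_of la t <= row_of la x)%N.
  by rewrite inE -/(inB x) => /orP[] // ->.
have gB x : inB x -> g x < 0.
  by case/andP=> /eqP cx; rewrite rtu => rx; have := sorted _ _ cx rx; rewrite /g; lia.
have gA x : x \in garnir_set la t u -> ~~ inB x -> 0 < g x.
  move=> xX /(inX _ xX)/andP[/eqP cx rx]; have := sorted _ _ (esym cx) rx; rewrite /g; lia.
have fixw x : x \notin garnir_set la t u -> w x = x by apply: out_perm.
have term y : (inB y)%:R * g y <= (inB (w^-1%g y))%:R * g y.
  case By : (inB y).
    by have := gB _ By; case: (inB _) => //; rewrite ?mul1r ?mul0r // => /ltW.
  rewrite mul0r; case: (boolP (y \in garnir_set la t u)) => yX.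
    by rewrite mulr_ge0 ?ler0n // ltW // gA ?By.
  have -> : w^-1%g y = y by apply: (@perm_inj _ w); rewrite permKV fixw.
  by rewrite By mul0r.
have [x nx] : exists x, col_of la (w x) != col_of la x.
  by apply/existsP; rewrite -negb_forall; apply: contra wC; rewrite inE.
have xX : x \in garnir_set la t u by apply: contraR nx => /fixw ->.
have wxX : w x \in garnir_set la t u by rewrite perm_closed.
have strict : (inB (w x))%:R * g (w x) < (inB (w^-1%g (w x)))%:R * g (w x).
  rewrite permK; case Bx : (inB x); case Bwx : (inB (w x)); rewrite ?mul0r ?mul1r.
  - by move: nx; have /andP[/eqP-> _] := Bx; have /andP[/eqP-> _] := Bwx; rewrite eqxx.
  - by apply: gA; rewrite ?Bwx.
  - exact: gB.
  - have /andP[/eqP e1 _] := inX _ xX (negbT Bx).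
    by have /andP[/eqP e2 _] := inX _ wxX (negbT Bwx); rewrite e1 e2 eqxx in nx.
have sumB : \sum_y (inB y)%:R * g y < \sum_y (inB y)%:R * g (w y).
  rewrite [ltRHS](reindex_inj (@perm_inj _ w^-1%g)) /=.
  under [ltRHS]eq_bigr do rewrite permKV.
  rewrite (bigD1 (w x)) //= [ltRHS](bigD1 (w x)) //=.
  by apply: ltr_leD => //; apply: ler_sum => y _.
have sumT : \sum_y ((T (w y))%:Z - (T y)%:Z) = 0.
  by rewrite sumrB (reindex_inj (@perm_inj _ w^-1%g)) /=; under eq_bigr do rewrite permKV; rewrite subrr.
have sumB' : 0 < \sum_y (inB y)%:R * ((T (w y))%:Z - (T y)%:Z).
  set D := \sum_y _; have : \sum_y (inB y)%:R * g (w y) - \sum_y (inB y)%:R * g y = D * 2%:Z.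
    by rewrite -sumrB /D mulr_suml; apply: eq_bigr => y _; rewrite /g; case: (inB y); lia.
  by move: sumB; lia.
rewrite -ltz_nat -subr_gt0 /col_weight !(big_morph Posz PoszD (erefl 0%:Z)) -sumrB.
(* On the belt, the column index is that of [t], plus the distance of the two columns on the right
   part; elsewhere [w] changes nothing. *)
rewrite (eq_bigr (fun y => (col_of la t)%:Z * ((T (w y))%:Z - (T y)%:Z) +
   (col_of la u - col_of la t)%N%:Z * ((inB y)%:R * ((T (w y))%:Z - (T y)%:Z)))) => [|y _].
  by rewrite big_split /= -!mulr_sumr sumT mulr0 add0r mulr_gt0 // ltz_nat subn_gt0.
rewrite ffunE invgK !PoszM -mulrBr; case: (boolP (y \in garnir_set la t u)) => yX; last first.
  by rewrite fixw // subrr !mulr0.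
case By : (inB y); last first.
  by have /andP[/eqP -> _] := inX _ yX (negbT By); rewrite mul0r mulr0 addr0.
rewrite mul1r -mulrDl; congr (_ * _); have /andP[/eqP -> _] := By; lia.
Qed.

Lemma young_col_garnir p (la : p.-tuple 'I_p.+1) n (T : {ffun 'I_p -> 'I_n})
    (t u : 'I_p) m (S : 'M[algC]_(m, _)) :
  is_partition la ->
  row_of la t = row_of la u -> (col_of la t < col_of la u)%N -> (T u < T t)%N ->
  (forall x y, col_of la x = col_of la y -> (row_of la x <= row_of la y)%N -> (T x <= T y)%N) ->
  (forall U : {ffun 'I_p -> 'I_n}, (col_weight la T < col_weight la U)%N -> (young_col la U <= S)%MS) ->
  (young_col la T <= S)%MS.
Proof.
move=> hla rtu ctu lt_T sorted subS; set X := garnir_set la t u.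
have G0 : young la (fun_repr p n) *m garnir X (fun_repr p n) = 0.
  by apply: young_garnir => h hC; apply: garnir_pigeonhole.
have rel : \sum_(w : 'S_p | perm_on X w) (-1) ^+ odd_perm w *: young_col la (fun_act T w^-1%g) = 0.
  transitivity ((young la (fun_repr p n) *m garnir X (fun_repr p n)
                   *m delta_mx (enum_rank T) (0 : 'I_1))^T); last by rewrite G0 mul0mx trmx0.
  rewrite /garnir mulmx_sumr mulmx_suml linear_sum; apply: eq_bigr => w _.
  by rewrite young_col_act -scalemxAr -scalemxAl linearZ.
(* Each [w] in the column group contributes the column of [T] itself, its sign occurring twice. All
   other terms have larger column weight. *)
pose N := #|[pred w : 'S_p | perm_on X w && (w \in col_group la)]|.
have N0 : N%:R != 0 :> algC.
  rewrite pnatr_eq0 -lt0n; apply/card_gt0P; exists 1%g.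
  by rewrite inE perm_on1; apply/col_groupP => x; rewrite perm1.
suff : (N%:R *: young_col la T <= S)%MS by rewrite (eqmx_scale _ N0).
have -> : N%:R *: young_col la T =
   - \sum_(w : 'S_p | perm_on X w && (w \notin col_group la))
        (-1) ^+ odd_perm w *: young_col la (fun_act T w^-1%g).
  apply/eqP; rewrite -addr_eq0 -[eqbRHS]rel [eqbRHS](bigID (fun w => w \in col_group la)) /=.
  rewrite eq_sym; apply/eqP; congr (_ + _); rewrite scaler_nat -sumr_const.
  apply: eq_bigr => w /andP[_ wC].
  by rewrite young_col_col // scalerA -expr2 sqrr_sign scale1r.
rewrite eqmx_opp summx_sub // => w /andP[wX wC]; apply: scalemx_sub; apply: subS.
exact: garnir_col_weight rtu ctu lt_T sorted wX wC.
Qed.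

(* A function V whose column is not in the span of the semistandard ones, and
   that is maximal for (col_weight, row_weight) ordered lexicographically, would
   itself be semistandard. *)
Lemma rank_young_le p (la : p.-tuple 'I_p.+1) n : is_partition la ->
  (\rank (young la (fun_repr p n)) <= schur_one n la)%N.
Proof.
move=> hla; rewrite [schur_one n la](_ : _ = #|ssyt la n|) //.
pose S := \matrix_(i < #|ssyt la n|) young_col la (enum_val i).
suff subS U : (young_col la U <= S)%MS.
  rewrite -mxrank_tr; apply: leq_trans (rank_leq_row S); apply: mxrankS; apply/row_subP => i.
  by rewrite -[i]enum_valK -tr_col colE; apply: subS.
(* A strict bound on row weights, so that [theta] encodes the lexicographic order in one number. *)
pose K := (p * (p * n)).+1.
have row_small (V : {ffun 'I_p -> 'I_n}) : (row_weight la V < K)%N.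
  rewrite /K ltnS; have -> : (p * (p * n) = \sum_(t < p) p * n)%N by rewrite sum_nat_const card_ord.
  by apply: leq_sum => t _; apply: leq_mul; apply: ltnW; [apply: row_of_lt|apply: (ltn_ord (V t))].
pose theta (V : {ffun 'I_p -> 'I_n}) := (col_weight la V * K + row_weight la V)%N.
apply: contraT => notS.
have [V notSV max_V] := arg_maxnP (P := fun V => ~~ (young_col la V <= S)%MS) theta notS.
have bigger W : (theta V < theta W)%N -> (young_col la W <= S)%MS.
  by move=> lt; apply: contraLR lt => /max_V; rewrite -leqNgt.
have swapped t u : col_of la t = col_of la u ->
    young_col la V = - young_col la (fun_act V (tperm t u)) \/ t = u.
  move=> ctu; case: (eqVneq t u) => [|ntu]; [by right|left].
  have := young_col_col V (tperm_col_group ctu); rewrite odd_tperm ntu expr1 tpermV => ->.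
  by rewrite scaleN1r opprK.
have injV t u : col_of la t = col_of la u -> V t = V u -> t = u.
  move=> ctu Vtu; have [e|//] := swapped t u ctu; case/negP: notSV.
  suff -> : young_col la V = 0 by apply: sub0mx.
  apply: eq_opp0; rewrite {1}e; congr (- young_col _ _).
  by apply/ffunP => x; rewrite ffunE tpermV; case: tpermP => // ->.
have colV t u : col_of la t = col_of la u -> (row_of la t < row_of la u)%N -> (V t < V u)%N.
  move=> ctu lt_r; case: (ltngtP (V t) (V u)) => // [lt_V|/val_inj/(injV _ _ ctu) e]; last first.
    by rewrite e ltnn in lt_r.
  have [e|e] := swapped t u ctu; last by rewrite e ltnn in lt_r.
  case/negP: notSV; rewrite e eqmx_opp; apply: bigger.
  rewrite /theta col_weight_col ?tperm_col_group // ltn_add2l.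
  have := sum_tperm_gt (f := fun x => V x) lt_r lt_V.
  by congr (_ < _)%N; apply: eq_bigr => x _; rewrite ffunE tpermV.
have sortedV x y : col_of la x = col_of la y -> (row_of la x <= row_of la y)%N -> (V x <= V y)%N.
  move=> cxy; rewrite leq_eqVlt => /orP[/eqP rxy|/(colV _ _ cxy)/ltnW //].
  by rewrite (cell_inj hla rxy cxy).
have subS' W : (col_weight la V < col_weight la W)%N -> (young_col la W <= S)%MS.
  by move=> lt; apply: bigger; have := row_small V; rewrite /theta; nia.
case/negP: notSV; case: (boolP (V \in ssyt la n)) => hV.
  have <- : row (enum_rank_in hV V) S = young_col la V by rewrite rowK enum_rankK_in.
  exact: row_sub.
case: (pickP (fun tu : 'I_p * 'I_p => [&& row_of la tu.1 == row_of la tu.2,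
   (col_of la tu.1 < col_of la tu.2)%N & (V tu.2 < V tu.1)%N])) => [[t u] /and3P[/= /eqP rtu ctu lt]|no].
  exact: young_col_garnir rtu ctu lt sortedV subS'.
case/negP: hV; apply/ssytP; split=> // t u rtu ctu.
by have := no (t, u); rewrite /= rtu eqxx ctu /= ltnNge => /negbFE.
Qed.

(** * Cycle types *)

Lemma expg_porbit_mod (T : finType) (s : {perm T}) x i j :
  ((s ^+ i)%g x == (s ^+ j)%g x) = (i == j %[mod #|porbit s x|])%N.
Proof.
set m := #|porbit s x|; have m0 : (0 < m)%N by apply/card_gt0P; exists x; apply: porbit_id.
have loop q : (s ^+ (q * m))%g x = x.
  elim: q => [|q IH]; first by rewrite mul0n expg0 perm1.
  by rewrite mulSn expgD permM [(s ^+ m)%g x]permX iter_porbit.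
have red k : (s ^+ k)%g x = nth x (traject s x m) (k %% m).
  by rewrite nth_traject ?ltn_pmod // {1}(divn_eq k m) expgD permM loop permX.
by rewrite !red nth_uniq ?size_traject ?ltn_pmod ?uniq_traject_porbit.
Qed.

Lemma eq_fibers_bij (T : finType) (A B : {set T}) (f : T -> nat) :
  (forall m, #|[set x in A | f x == m]| = #|[set x in B | f x == m]|) ->
  exists phi : T -> T, {in A, forall x, phi x \in B /\ f (phi x) = f x}
                     /\ {in A &, injective phi}.
Proof.
move=> eqc; pose EA m := enum [set x in A | f x == m]; pose EB m := enum [set x in B | f x == m].
have szE m : size (EA m) = size (EB m) by rewrite -!cardE.
pose phi x := nth x (EB (f x)) (index x (EA (f x))).
have memA x : x \in A -> x \in EA (f x) by rewrite mem_enum inE eqxx andbT.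
have lt_i x : x \in A -> (index x (EA (f x)) < size (EB (f x)))%N.
  by move=> /memA; rewrite -szE index_mem.
have phiP x : x \in A -> phi x \in B /\ f (phi x) = f x.
  by move=> /lt_i/(mem_nth x); rewrite mem_enum inE => /andP[? /eqP].
exists phi; split=> // x y xA yA e.
have fxy : f x = f y by have [_ <-] := phiP x xA; have [_ <-] := phiP y yA; rewrite e.
move: e; rewrite /phi fxy (set_nth_default y) -?fxy ?lt_i // fxy => /eqP.
rewrite nth_uniq ?enum_uniq ?lt_i //; last by rewrite -fxy lt_i.
move=> /eqP /(congr1 (nth x (EA (f y)))); rewrite !nth_index -?fxy ?memA // fxy.
exact: memA.
Qed.

(* The partition attached to s is the conjugate of its cycle type: part i is the
   number of cycles with more than i elements, so that no sorting is needed. *)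
Definition long_cycles p (s : 'S_p) i := #|[set X in porbits s | (i < #|X|)%N]|.

Definition cycle_type p (s : 'S_p) : p.-tuple 'I_p.+1 :=
  mktuple (fun i : 'I_p => inord (long_cycles s i)).

Lemma card_porbits_le (T : finType) (s : {perm T}) : (#|porbits s| <= #|T|)%N.
Proof. exact: leq_imset_card. Qed.

Lemma sum_card_porbits (T : finType) (s : {perm T}) : (\sum_(X in porbits s) #|X| = #|T|)%N.
Proof.
rewrite -sum1_card (partition_big (porbit s) (mem (porbits s))) /=; last by move=> x _; apply: imset_f.
apply: eq_bigr => _ /imsetP[y _ ->]; rewrite -sum1_card; apply: eq_bigl => x.
by rewrite -eq_porbit_mem.
Qed.

Lemma cycle_typeE p (s : 'S_p) (i : 'I_p) : tnth (cycle_type s) i = long_cycles s i :> nat.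
Proof.
rewrite tnth_mktuple inordK // ltnS -[leqRHS]card_ord.
apply: leq_trans (card_porbits_le s); apply/subset_leq_card/subsetP => X.
by rewrite inE => /andP[].
Qed.

Lemma cycle_type_partition p (s : 'S_p) : is_partition (cycle_type s).
Proof.
apply/andP; split.
  apply/forallP => i; apply/forallP => j; apply/implyP => le_ij; rewrite !cycle_typeE.
  apply/subset_leq_card/subsetP => X; rewrite !inE => /andP[-> lt].
  exact: leq_ltn_trans le_ij lt.
apply/eqP; under eq_bigr do rewrite cycle_typeE.
rewrite -[RHS]card_ord -(sum_card_porbits s).
under eq_bigr do rewrite /long_cycles -sum1_card big_mkcond.
rewrite exchange_big [RHS]big_mkcond; apply: eq_bigr => X _.
case: (boolP (X \in porbits s)) => hX; last by rewrite big1 // => i _; rewrite inE (negPf hX).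
have le_X : (#|X| <= p)%N by rewrite -[leqRHS]card_ord max_card.
rewrite -big_mkcond /= sum1_card -[RHS](card_ord_lt le_X); apply: eq_card => i.
transitivity (X \in [set Y in porbits s | (i < #|Y|)%N]); first by [].
by rewrite !inE hX.
Qed.

(** Cycles of equal length are matched by [phi], and s^i of the representative of a cycle is sent to
    u^i of the representative of its partner. Injectivity holds because these powers coincide modulo
    the same length. *)
Lemma cycle_type_conj p (s u : 'S_p) : cycle_type s = cycle_type u -> exists g, (s ^ g)%g = u.
Proof.
move=> eq_t.
have eq_long i : long_cycles s i = long_cycles u i.
  have [lt_i|le_i] := ltnP i p; first by rewrite -(cycle_typeE s (Ordinal lt_i)) eq_t cycle_typeE.
  by rewrite /long_cycles !eq_card0 // => X; rewrite inE ltnNge (leq_trans _ le_i) ?andbF //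
    -[leqRHS]card_ord max_card.
have split_card (v : 'S_p) m : (#|[set X in porbits v | #|X| == m.+1]| = long_cycles v m - long_cycles v m.+1)%N.
  rewrite /long_cycles -[X in (X - _)%N](cardsID [set X : {set 'I_p} | (m.+1 < #|X|)%N]).
  rewrite [X in (X + _ - _)%N](_ : _ = #|[set X in porbits v | (m.+1 < #|X|)%N]|); last first.
    by apply: eq_card => X; rewrite !inE; case: (X \in _) => //=; lia.
  rewrite addKn; apply: eq_card => X; rewrite !inE; case: (X \in _); rewrite ?andbF //=; lia.
have eq_cnt m : #|[set X in porbits s | #|X| == m]| = #|[set X in porbits u | #|X| == m]|.
  case: m => [|m]; last by rewrite !split_card !eq_long.
  rewrite !eq_card0 // => X; rewrite inE; apply/negP => /andP[/imsetP[x _ ->]];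
    by rewrite cards_eq0 => /eqP/setP/(_ x); rewrite inE porbit_id.
have [phi [phiP phi_inj]] := eq_fibers_bij eq_cnt.
(* The default [x] is reached only for empty [X], so on a cycle the representative does not depend
   on it ([rep_eq]). *)
pose rep (X : {set 'I_p}) x := odflt x [pick y in X].
have repP (X : {set 'I_p}) x y : y \in X -> rep X x \in X.
  by rewrite /rep; case: pickP => //= no yX; have := no y; rewrite /= yX.
have rep_eq (X : {set 'I_p}) x x' : x \in X -> rep X x = rep X x'.
  by rewrite /rep; case: pickP => //= no xX; have := no x; rewrite /= xX.
have powP x : exists i, x == (s ^+ i)%g (rep (porbit s x) x).
  have /porbitP[i e] : x \in porbit s (rep (porbit s x) x).
    by rewrite porbit_sym (repP _ _ x) ?porbit_id.
  by exists i; apply/eqP.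
pose pw x := ex_minn (powP x).
pose im x := rep (phi (porbit s x)) x.
pose g x := (u ^+ pw x)%g (im x).
have pwE x : (s ^+ pw x)%g (rep (porbit s x) x) = x.
  by rewrite /pw; case: ex_minnP => i /eqP.
have porb x : porbit s x \in porbits s by apply: imset_f.
have imP x : porbit u (im x) = phi (porbit s x).
  have [/imsetP[y _ e] _] := phiP _ (porb x); rewrite e; apply/eqP; rewrite eq_porbit_mem.
  by rewrite /im e (repP _ _ y) ?porbit_id.
have sameP x y : porbit s x = porbit s y -> im x = im y /\ rep (porbit s x) x = rep (porbit s y) y.
  move=> e; rewrite /im e; split; last by apply: rep_eq; rewrite -e porbit_id.
  have [/imsetP[z _ ->] _] := phiP _ (porb y).
  by rewrite -(rep_eq _ z) ?porbit_id //; apply: rep_eq; apply: porbit_id.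
have transfer x i j : ((s ^+ i)%g (rep (porbit s x) x) == (s ^+ j)%g (rep (porbit s x) x))
                    = ((u ^+ i)%g (im x) == (u ^+ j)%g (im x)).
  have rx : porbit s (rep (porbit s x) x) = porbit s x.
    by apply/eqP; rewrite eq_porbit_mem (repP _ _ x) ?porbit_id.
  by rewrite !expg_porbit_mod imP rx; have [_ ->] := phiP _ (porb x).
have inj_g : injective g.
  move=> x y e; have exy : porbit s x = porbit s y.
    apply: phi_inj; rewrite ?porb // -!imP -(porbit_perm u (pw x)) -/(g x) e.
    by rewrite porbit_perm.
  have [e1 e2] := sameP _ _ exy.
  rewrite -[x]pwE -[y]pwE -e2; apply/eqP; rewrite transfer; apply/eqP.
  by move: e; rewrite /g e1.
exists (perm inj_g); apply/permP => y.
rewrite -[y](permKV (perm inj_g)); set x := (perm inj_g)^-1%g y.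
rewrite conjgE -permM !mulgA mulgV mul1g permM !permE.
have exs : porbit s (s x) = porbit s x by rewrite -[s x]/((s ^+ 1)%g x) porbit_perm.
have [e1 e2] := sameP _ _ exs.
have -> : u (g x) = (u ^+ (pw x).+1)%g (im x) by rewrite expgSr permM.
rewrite {1}/g e1; apply/eqP; rewrite -transfer -e2 pwE e2.
by rewrite expgSr permM pwE.
Qed.

(** * The Weingarten function as a convolution inverse *)

Lemma card_classes_Sym p :
  (#|classes (Defs.Sym p)| <= #|[set la : p.-tuple 'I_p.+1 | is_partition la]|)%N.
Proof.
pose f (A : {set 'S_p}) := cycle_type (repr A).
have inj_f : {in classes (Defs.Sym p) &, injective f}.
  move=> A B /repr_classesP[_ eA] /repr_classesP[_ eB] /cycle_type_conj[g e].
  by rewrite eA eB -e classGidl ?inE.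
rewrite -(card_in_imset inj_f); apply/subset_leq_card/subsetP => _ /imsetP[A _ ->].
by rewrite inE cycle_type_partition.
Qed.

Lemma sum_chi p (F : 'CF(Defs.Sym p) -> algC) :
  \sum_(la : p.-tuple 'I_p.+1 | is_partition la) F (chi la) = \sum_i F 'chi_i.
Proof.
pose P := [set la : p.-tuple 'I_p.+1 | is_partition la].
have irr_chi la : la \in P -> chi la \in irr (Defs.Sym p).
  by rewrite inE => hla; rewrite irrEchar chi_char chi_norm1 /=.
pose h (la : p.-tuple 'I_p.+1) := cfIirr (chi la).
have hE la : la \in P -> 'chi_(h la) = chi la by move=> hla; rewrite cfIirrE ?irr_chi.
have inj_h : {in P &, injective h}.
  move=> la mu hla hmu e; apply/eqP; apply: contraT => nlm; move: (hla) (hmu); rewrite !inE => pla pmu.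
  have := chi_ortho pla pmu nlm; rewrite -(hE la) // -(hE mu) // e cfnorm_irr => /eqP.
  by rewrite oner_eq0.
have full : h @: P = [set: Iirr (Defs.Sym p)].
  apply/eqP; rewrite eqEcard subsetT cardsT (card_in_imset inj_h).
  by have := card_classes_Sym p; rewrite -NirrE -[X in (X <= _)%N]card_ord.
transitivity (\sum_(i in h @: P) F 'chi_i).
  rewrite big_imset //=; apply: eq_big => la; first by rewrite inE.
  by move=> hla; rewrite hE // inE.
by rewrite full; apply: eq_bigl => i; rewrite inE.
Qed.

Lemma card_fixed_fun p n (s : 'S_p) :
  #|[set f : {ffun 'I_p -> 'I_n} | fun_act f s == f]| = (n ^ #|porbits s|)%N.
Proof.
pose orb := {X : {set 'I_p} | X \in porbits s}.
have porb t : porbit s t \in porbits s by apply: imset_f.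
pose pt t : orb := exist (fun X : {set 'I_p} => X \in porbits s) _ (porb t).
pose G (phi : {ffun orb -> 'I_n}) : {ffun 'I_p -> 'I_n} := [ffun t => phi (pt t)].
have ex (X : orb) : exists t, sval X == porbit s t.
  by have /imsetP[t _ e] := svalP X; exists t; apply/eqP.
have GE (phi : {ffun orb -> 'I_n}) (X : orb) : phi X = G phi (xchoose (ex X)).
  by rewrite ffunE; congr (phi _); apply/val_inj/eqP; apply: (xchooseP (ex X)).
have inj_G : injective G by move=> phi psi e; apply/ffunP => X; rewrite !GE e.
have -> : (n ^ #|porbits s|)%N = #|{ffun orb -> 'I_n}| by rewrite card_ffun card_ord card_sig.
rewrite -cardsT -(card_imset _ inj_G); apply: eq_card => f; rewrite inE.
apply/eqP/imsetP => [fix_f|[phi _ ->]]; last first.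
  apply/ffunP => t; rewrite !ffunE; congr (phi _); apply: val_inj => /=.
  by rewrite -porbitV -[s^-1%g t]/((s^-1 ^+ 1)%g t) porbit_perm porbitV.
have step t : f (s t) = f t by rewrite -[in LHS]fix_f ffunE permK.
have const t i : f ((s ^+ i)%g t) = f t.
  elim: i => [|i IH]; first by rewrite expg0 perm1.
  by rewrite expgSr permM step.
exists [ffun X => f (xchoose (ex X))]; first by rewrite inE.
apply/ffunP => t; rewrite !ffunE; have /= := xchooseP (ex (pt t)); rewrite eq_porbit_mem => /porbitP[i {1}->].
exact: const.
Qed.

Lemma fun_char_val p n (s : 'S_p) :
  cfRepr (fun_repr p n) s = (n ^ #|porbits s|)%N%:R.
Proof.
rewrite cfunE inE mulr1n -card_fixed_fun -sum1_card natr_sum [RHS]big_mkcond /=.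
rewrite /mxtrace (reindex (@enum_rank {ffun 'I_p -> 'I_n})) /=; last first.
  by exists enum_val => i _; rewrite ?enum_rankK ?enum_valK.
apply: eq_bigr => f _; rewrite !mxE enum_rankK (inj_eq enum_rank_inj) eqxx /= eq_sym inE.
by case: eqP.
Qed.


Lemma cfdot_fun_chi p n (la : p.-tuple 'I_p.+1) : is_partition la ->
  '[cfRepr (fun_repr p n), chi la] = (schur_one n la)%:R.
Proof.
move=> hla; rewrite cfdot_repr_chi //; congr (_%:R); apply/eqP.
by rewrite eqn_leq rank_young_le // rank_young_ge.
Qed.

Lemma schur_one_gt0 p n (la : p.-tuple 'I_p.+1) : is_partition la -> (p <= n)%N ->
  (0 < schur_one n la)%N.
Proof.
move=> hla le_pn; have lt_n t : (row_of la t < n)%N by apply: leq_trans (row_of_lt _ hla) le_pn.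
rewrite [schur_one n la](_ : _ = #|ssyt la n|) //; apply/card_gt0P.
by exists [ffun t => Ordinal (lt_n t)]; apply/ssytP; split=> t u e lt; rewrite !ffunE /= ?e.
Qed.

Lemma WgE p n (s : 'S_p) : Wg n s = (p`!%:R ^+ 2)^-1 *
  \sum_i 'chi[Defs.Sym p]_i 1%g ^+ 2 * 'chi_i s / '[cfRepr (fun_repr p n), 'chi_i].
Proof.
rewrite /Wg -(sum_chi (fun f => f 1%g ^+ 2 * f s / '[cfRepr (fun_repr p n), f])).
by congr (_ * _); apply: eq_bigr => la hla; rewrite cfdot_fun_chi.
Qed.

Lemma cfdot_fun_irr_neq0 p n (i : Iirr (Defs.Sym p)) : (p <= n)%N ->
  '[cfRepr (fun_repr p n), 'chi_i] != 0.
Proof.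
move=> le_pn.
(* Counting the vanishing multiplicities over partitions gives zero, so none vanishes over the
   irreducible characters. *)
have := sum_chi (fun f => (('[cfRepr (fun_repr p n), f] == 0) : nat)%:R : algC).
rewrite big1 => [/esym/eqP|la hla]; last first.
  by rewrite cfdot_fun_chi // pnatr_eq0 eqn0Ngt schur_one_gt0.
rewrite psumr_eq0 => [/allP/(_ i)|j _]; last exact: ler0n.
by rewrite mem_index_enum pnatr_eq0 eqb0; apply.
Qed.

(** Distinct irreducible characters convolve to zero, so each multiplicity in pi meets only its own
    inverse in [Wg]; the regular character over p! remains. *)
Lemma Wg_inverse p n (x : 'S_p) : (p <= n)%N ->
  \sum_y Wg n y * (n ^ #|porbits (y^-1 * x)%g|)%N%:R = (x == 1%g)%:R.
Proof.
move=> le_pn; pose m i := '[cfRepr (fun_repr p n), 'chi[Defs.Sym p]_i].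
have m0 i : m i != 0 by apply: cfdot_fun_irr_neq0.
have fE s : (n ^ #|porbits s|)%N%:R = \sum_i m i * 'chi[Defs.Sym p]_i s.
  rewrite -fun_char_val {1}[cfRepr _](cfun_sum_cfdot) sum_cfunE.
  by apply: eq_bigr => i _; rewrite cfunE.
have conv i j : \sum_y 'chi[Defs.Sym p]_i y * 'chi_j (y^-1 * x)%g
    = p`!%:R * ((i == j)%:R * ('chi_i x / 'chi_i 1%g)).
  rewrite -generalized_orthogonality_relation card_SymG mulVKf ?factC_neq0 //.
  rewrite (reindex_inj (mulIg x)); apply: eq_big => y; first by rewrite inE.
  move=> _; congr (_ * _); rewrite invMg -mulgA.
  by rewrite -[(x^-1 * _)%g]/(y^-1 ^ x)%g cfunJ ?inE.
pose a i := 'chi[Defs.Sym p]_i 1%g ^+ 2 / m i.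
have -> : \sum_y Wg n y * (n ^ #|porbits (y^-1 * x)%g|)%N%:R =
   (p`!%:R ^+ 2)^-1 * \sum_i \sum_j a i * m j *
      \sum_y 'chi[Defs.Sym p]_i y * 'chi_j (y^-1 * x)%g.
  under eq_bigr => y _ do rewrite WgE fE -mulrA mulr_suml.
  rewrite -mulr_sumr exchange_big; congr (_ * _); apply: eq_bigr => i _.
  under eq_bigr do rewrite mulr_sumr.
  rewrite exchange_big; apply: eq_bigr => j _; rewrite mulr_sumr; apply: eq_bigr => y _.
  by rewrite /a [X in X * _]mulrAC mulrACA.
transitivity ((p`!%:R)^-1 * \sum_i 'chi[Defs.Sym p]_i 1%g * 'chi_i x).
  rewrite expr2 invfM -mulrA; congr (_ * _); rewrite mulr_sumr; apply: eq_bigr => i _.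
  rewrite (bigD1 i) //= [X in _ + X]big1 => [|j nji]; last first.
    by rewrite conv eq_sym (negPf nji) mul0r !mulr0.
  rewrite addr0 conv eqxx mul1r /a mulfVK // mulrCA mulKf ?factC_neq0 //.
  by rewrite expr2 -mulrA [_ * (_ / _)]mulrCA mulfV ?irr1_neq0 ?mulr1.
have := congr1 (fun f : 'CF(Defs.Sym p) => f x) (cfReg_sum (Defs.Sym p)).
rewrite cfRegE sum_cfunE card_SymG => e.
rewrite (eq_bigr (fun i => ('chi_i 1%g *: 'chi[Defs.Sym p]_i) x)) => [|i _]; last by rewrite cfunE.
by rewrite -e; case: eqP; rewrite ?mulr1n ?mulr0n ?mulr0 ?mulVf ?factC_neq0.
Qed.

(** * Counting permutations by length *)

Lemma card_porbits_Sn p (s : 'S_p) : (#|porbits s| <= p)%N.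
Proof. by have := card_porbits_le s; rewrite card_ord. Qed.

Lemma card_porbits1 p : #|porbits (1%g : 'S_p)| = p.
Proof.
rewrite card_imset ?card_ord // => x y /eqP; rewrite eq_porbit_mem => /porbitP[i ->].
by rewrite expg1n perm1.
Qed.

Lemma porbits_split p (s : 'S_p) : s != 1%g ->
  exists x y, x != y /\ #|porbits (tperm x y * s)%g| = #|porbits s|.+1.
Proof.
move=> s1; have [x sx] : exists x, s x != x.
  by apply/existsP; rewrite -negb_forall; apply: contra s1 => /forallP h; apply/eqP/permP => x;
    rewrite perm1; apply/eqP.
exists x, (s x); rewrite eq_sym sx; split=> //.
have := porbits_mul_tperm s x (s x); rewrite /= eq_sym sx.
have -> : x \in porbit s (s x) by rewrite porbit_sym -[s x]/((s ^+ 1)%g x) mem_porbit.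
by rewrite addn0 addn1.
Qed.

Lemma perm_length_mul p (s t : 'S_p) :
  (perm_length (s * t)%g <= perm_length s + perm_length t)%N.
Proof.
elim: {s}(perm_length s) {-2}s (erefl (perm_length s)) => [|m IH] s es.
  have [->|/porbits_split[x [y [_ e]]]] := eqVneq s 1%g; first by rewrite mul1g leq_addl.
  by have := card_porbits_Sn (tperm x y * s); rewrite e; move: es; rewrite /perm_length; lia.
have [e1|/porbits_split[x [y [nxy e]]]] := eqVneq s 1%g.
  by rewrite e1 mul1g leq_addl.
have es' : perm_length (tperm x y * s)%g = m by move: es; rewrite /perm_length e; lia.
have := IH _ es'; have := porbits_mul_tperm (s * t)%g x y; rewrite /= nxy mulgA.
have := card_porbits_Sn (tperm x y * s * t); move: es es'; rewrite /perm_length.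
rewrite addn1; move: (#|porbits (s * t)%g|) (#|porbits (tperm x y * s * t)%g|) (_.*2)%N; lia.
Qed.

Lemma fun_act_toP p n : forall f : {ffun 'I_p -> 'I_n}, act_morph (@fun_act p n) f.
Proof. by move=> f s t; apply: fun_actM. Qed.

Definition fun_action p n := TotalAction (@fun_act1 p n) (@fun_act_toP p n).

(** An orbit is a multiset of values, represented by its sorted tuple. *)
Lemma card_fun_orbits p m :
  (#|orbit (fun_action p m.+1) [set: 'S_p] @: [set: {ffun 'I_p -> 'I_m.+1}]| <= 'C(p + m, p))%N.
Proof.
rewrite -card_sorted_tuples.
pose o (t : p.-tuple 'I_m.+1) := orbit (fun_action p m.+1) [set: 'S_p] [ffun i => tnth t i].
apply: leq_trans (leq_imset_card o _); apply/subset_leq_card/subsetP => _ /imsetP[f _ ->].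
pose le_ord (i j : 'I_m.+1) := (i <= j)%N.
pose t := mktuple f; pose ts := [tuple of sort le_ord t].
have /tuple_permP[s es] : perm_eq ts t by rewrite perm_sort.
apply/imsetP; exists ts.
  by rewrite inE sorted_map; apply: sort_sorted => i j; apply: leq_total.
apply/esym/eqP; rewrite orbit_eq_mem; apply/orbitP; exists s^-1%g; rewrite ?inE //.
apply/ffunP => i; rewrite /= !ffunE invgK.
have -> : ts = [tuple tnth t (s i) | i < p] by apply: val_inj.
by rewrite !tnth_mktuple.
Qed.

Lemma sum_pow_porbits p m :
  (\sum_(z : 'S_p) m.+1 ^ #|porbits z| <= (p + m) ^_ p)%N.
Proof.
rewrite -bin_ffact; apply: leq_trans (leq_mul (card_fun_orbits p m) (leqnn _)).
rewrite -[X in (_ * X)%N]card_Sn -cardsT -Frobenius_Cauchy; last first.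
  by apply/actsP => s _ f; rewrite !inE.
rewrite [leqRHS]big_mkcond /=; apply: leq_sum => z _; rewrite inE -card_fixed_fun.
apply/subset_leq_card/subsetP => f; rewrite inE => /eqP fz.
by rewrite inE inE; apply/afix1P.
Qed.

(** With M = m + 1, the falling factorial is prod_(i < k) (M + i). The bound is M^k (1 + x + x^2)
    for x = k (k - 1) / (2 M), the sum of the i / M, with denominators cleared; x <= 1/2 makes the
    bracket at most 7/4. *)
Lemma ffact_bound k m : (k * k.-1 <= m.+1)%N ->
  (4 * m.+1 ^ 2 * (k + m) ^_ k
    <= m.+1 ^ k * (4 * m.+1 ^ 2 + 2 * (k * k.-1) * m.+1 + (k * k.-1) ^ 2))%N.
Proof.
elim: k => [|k IH] hk; first by rewrite ffactn0 expn0; lia.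
have hk' : (k * k.-1 <= m.+1)%N by apply: leq_trans hk; nia.
rewrite addSn ffactSS [(m.+1 ^ k.+1)%N]expnS.
have {}IH := IH hk'; rewrite /= in hk *.
set M := m.+1 in hk hk' IH *.
have -> : (k + m).+1 = (M + k)%N by rewrite /M; lia.
have -> : (k.+1 * k = k * k.-1 + 2 * k)%N by case: (k) => // j /=; lia.
move: (k * k.-1)%N hk' IH => D hD IH.
apply: (@leq_trans ((M + k) * (M ^ k * (4 * M ^ 2 + 2 * D * M + D ^ 2)))).
  by move: ((k + m) ^_ k)%N IH => A IH; rewrite mulnCA leq_mul2l IH orbT.
rewrite mulnCA -[leqRHS]mulnA [leqRHS]mulnCA leq_mul2l; apply/orP; right.
nia.
Qed.

Lemma sum_pow_porbits_sq p : (0 < p)%N ->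
  (4 * \sum_(z : 'S_p) (p ^ 2) ^ #|porbits z| <= 7 * (p ^ 2) ^ p)%N.
Proof.
move=> p0; have [m em] : exists m, (p ^ 2 = m.+1)%N.
  by exists (p ^ 2).-1; rewrite prednK // expn_gt0 p0.
have hD : (p * p.-1 <= m.+1)%N by rewrite -em; nia.
rewrite em; have := sum_pow_porbits p m; have := ffact_bound hD.
move: (\sum_(z : 'S_p) _)%N ((p + m) ^_ p)%N (m.+1 ^ p)%N => A B' E.
move: (p * p.-1)%N hD => D hD; set M := m.+1 in hD * => h1 h2.
have M0 : (0 < M ^ 2)%N by rewrite expn_gt0.
have h3 : (4 * M ^ 2 + 2 * D * M + D ^ 2 <= 7 * M ^ 2)%N by nia.
have h4 := leq_mul (leqnn E) h3; have h5 := leq_mul (leqnn (4 * M ^ 2)) h2.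
by rewrite -(leq_pmul2l M0); move: (M ^ 2)%N M0 h1 h4 h5 => Q *; lia.
Qed.

(** * The estimate *)

Lemma Wg_real p n (s : 'S_p) : Wg n s \is Num.real.
Proof.
rewrite /Wg rpredM ?rpredV ?rpredX ?realn // rpred_sum // => la hla.
by rewrite rpredM ?rpredV ?realn // rpredM ?rpredX ?chi_real.
Qed.

Lemma perm_length_porbits p (s : 'S_p) : (perm_length s + #|porbits s| = p)%N.
Proof. by rewrite subnK ?card_porbits_Sn. Qed.

(** Since |z| + #z = p, the powers of n combine to n^p, and the remaining sum depends on p alone. *)
Lemma weight_sum p n : (0 < p)%N ->
  \sum_(z : 'S_p | z != 1%g) (n%:R / (p ^ 2)%:R) ^+ perm_length z * (n ^ #|porbits z|)%N%:R
    <= (3%:R / 4%:R) * n%:R ^+ p :> algC.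
Proof.
move=> p0; set q : algC := (p ^ 2)%:R.
have q0 : 0 < q by rewrite ltr0n expn_gt0 p0.
have termE (z : 'S_p) : (n%:R / q) ^+ perm_length z * (n ^ #|porbits z|)%N%:R
    = n%:R ^+ p / q ^+ p * ((p ^ 2) ^ #|porbits z|)%N%:R.
  rewrite [(n ^ _)%:R]natrX [((_ ^ 2) ^ _)%:R]natrX -/q expr_div_n.
  have split_exp (a : algC) : a ^+ p = a ^+ perm_length z * a ^+ #|porbits z|.
    by rewrite -exprD perm_length_porbits.
  have nz c : q ^+ c != 0 by rewrite expf_neq0 // gt_eqF.
  by rewrite (split_exp n%:R) (split_exp q) invfM mulrACA -!mulrA mulVf ?mulr1.
rewrite (eq_bigr _ (fun z _ => termE z)) -mulr_sumr.
have sum_le : \sum_(z : 'S_p | z != 1%g) ((p ^ 2) ^ #|porbits z|)%N%:R <= (3%:R / 4%:R) * q ^+ p.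
  have := sum_pow_porbits_sq p0; rewrite (bigD1 1%g) //= card_porbits1 -(ler_nat algC) !natrM natrD.
  rewrite [X in _ * (X + _)]natrX natr_sum -[X in 7%:R * X]/(((p ^ 2) ^ p)%:R) [X in 7%:R * X]natrX -/q.
  rewrite mulrDr -lerBrDl -mulrBl => h.
  have four : 4%:R != 0 :> algC by rewrite pnatr_eq0.
  rewrite -(ler_pM2l (ltr0Sn _ 3)) [leRHS]mulrA [4%:R * (_ / _)]mulrC divfK //.
  by apply: le_trans h _; rewrite -natrB.
apply: le_trans (ler_wpM2l _ sum_le) _.
  by rewrite divr_ge0 ?exprn_ge0 ?ler0n ?ltW.
by rewrite mulrCA mulfVK ?expf_neq0 ?gt_eqF.
Qed.

Lemma Wg_norm_le p n (s : 'S_p) : (0 < p)%N -> (p ^ 2 <= n)%N ->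
  `|Wg n s| <= 4%:R * (n%:R ^- p * ((p ^ 2)%:R / n%:R) ^+ perm_length s).
Proof.
move=> p0 le_n; have n0 : (0 < n)%N by apply: leq_trans le_n; rewrite expn_gt0 p0.
have le_pn : (p <= n)%N by apply: leq_trans le_n; rewrite -mulnn leq_pmulr.
pose w : algC := n%:R / (p ^ 2)%:R; pose a (y : 'S_p) := `|Wg n y| * w ^+ perm_length y.
have q0 : 0 < (p ^ 2)%:R :> algC by rewrite ltr0n expn_gt0 p0.
have w1 : 1 <= w by rewrite ler_pdivlMr // mul1r ler_nat.
have w0 : 0 < w by apply: lt_le_trans w1.
have N0 : 0 < n%:R ^+ p :> algC by rewrite exprn_gt0 // ltr0n.
(* The term y = x of the convolution identity is isolated. As w >= 1, subadditivity of the length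
   splits the weight of x over y and y^-1 x. *)
have step x : a x * n%:R ^+ p <= (x == 1%g)%:R +
    \sum_(y | y != x) a y * (w ^+ perm_length (y^-1 * x)%g * (n ^ #|porbits (y^-1 * x)%g|)%N%:R).
  have e : Wg n x * n%:R ^+ p = (x == 1%g)%:R -
      \sum_(y | y != x) Wg n y * (n ^ #|porbits (y^-1 * x)%g|)%N%:R.
    by rewrite -(Wg_inverse x le_pn) (bigD1 x) //= mulVg card_porbits1 natrX addrK.
  have -> : a x * n%:R ^+ p = `|Wg n x * n%:R ^+ p| * w ^+ perm_length x.
    by rewrite normrM (ger0_norm (ltW N0)) mulrAC.
  rewrite e; apply: le_trans (ler_wpM2r _ (ler_normB _ _)) _; first exact/exprn_ge0/ltW.
  rewrite mulrDl; apply: lerD.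
    case: eqP => [->|_]; last by rewrite normr0 mul0r.
    by rewrite /perm_length card_porbits1 subnn expr0 mulr1 normr1.
  apply: le_trans (ler_wpM2r _ (ler_norm_sum _ _ _)) _; first exact/exprn_ge0/ltW.
  rewrite mulr_suml; apply: ler_sum => y _; rewrite normrM normr_nat -!mulrA.
  rewrite ler_wpM2l // mulrC mulrA ler_wpM2r ?ler0n // -exprD ler_weXn2l //.
  by rewrite -{1}[x](mulKVg y); apply: perm_length_mul.
pose S := \sum_x a x.
have Sle : S * n%:R ^+ p <= 4%:R.
  (* Summed over x, the inequality has 3/4 of its left side on the right, which is then absorbed. *)
  have : S * n%:R ^+ p <= 1 + S * ((3%:R / 4%:R) * n%:R ^+ p).
    rewrite mulr_suml; apply: le_trans (ler_sum _ (fun x _ => step x)) _.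
    rewrite big_split /= (bigD1 1%g) //= eqxx big1 => [|x /negPf -> //].
    rewrite addr0 lerD2l (exchange_big_dep predT) //= mulr_suml; apply: ler_sum => y _.
    rewrite -mulr_sumr ler_wpM2l ?mulr_ge0 ?exprn_ge0 ?(ltW w0) //.
    apply: le_trans (weight_sum n p0); rewrite [leLHS](reindex_inj (mulgI y)) /=.
    rewrite le_eqVlt; apply/orP; left; apply/eqP; apply: eq_big => [x|x _]; last by rewrite mulKg.
    by rewrite -{1}[y]mulg1 (inj_eq (mulgI y)) eq_sym.
  rewrite mulrCA; move: (S * _) => A; rewrite -lerBlDr -{1}[A]mul1r -mulrBl.
  have -> : 1 - 3%:R / 4%:R = 4%:R^-1 :> algC.
    have four : 4%:R != 0 :> algC by rewrite pnatr_eq0.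
    by apply: (mulIf four); rewrite mulrBl mul1r divfK // mulVf // -natrB.
  by rewrite ler_pdivrMl ?mulr1 ?ltr0n.
have a_le : a s <= S.
  rewrite /S (bigD1 s) //= lerDl sumr_ge0 // => y _.
  by rewrite mulr_ge0 ?exprn_ge0 ?(ltW w0).
rewrite (_ : (p ^ 2)%:R / n%:R = w^-1); last by rewrite invf_div.
rewrite mulrA exprVn ler_pdivlMr ?exprn_gt0 // -/(a s).
by rewrite ler_pdivlMr //; apply: le_trans Sle; rewrite ler_wpM2r // ltW.
Qed.

(* n^{-p-|s|(1-2/k)} = n^{-(p+|s|)} * (n^{1/k})^{2|s|}, with n^{1/k} the
   positive real k-th root k.-root n in algC. *)
Theorem theorem4 (k : nat) (hk : (2 <= k)%N) :
  exists K : algC,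
    forall (p n : nat) (s : 'S_p), (1 <= p)%N -> (p ^ k <= n)%N ->
      Wg n s <= K * ((n%:R : algC) ^- (p + perm_length s)
                      * (k.-root (n%:R : algC)) ^+ (2 * perm_length s)).
Proof.
exists 4%:R => p n s p0 le_n.
have le_n2 : (p ^ 2 <= n)%N by apply: leq_trans le_n; rewrite leq_pexp2l.
apply: le_trans (real_ler_norm (Wg_real n s)) _.
apply: le_trans (Wg_norm_le s p0 le_n2) _.
rewrite ler_pM2l ?ltr0n // exprD invfM -mulrA ler_wpM2l ?invr_ge0 ?exprn_ge0 ?ler0n //.
rewrite expr_div_n [leRHS]mulrC ler_wpM2r ?invr_ge0 ?exprn_ge0 ?ler0n // natrX -exprM.
have k0 : (0 < k)%N by apply: leq_trans hk.
apply: lerXn2r; rewrite ?nnegrE ?ler0n ?rootC_ge0 //.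
by rewrite -(ler_pXn2r k0) ?nnegrE ?ler0n ?rootC_ge0 // rootCK // -natrX ler_nat.
Qed.
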